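(* Let $X=V(f)\overset{i}{\hookrightarrow}\mathbb{P}^3$ be a smooth hypersurface of degree $d_1\ge 2$ in complex projective space, and let $d$ be an integer. Then $X$ admits a foliation with tangent sheaf $i^{*}\mathcal{O}_{\mathbb{P}^3}(1-d)$ if and only if $d\ge d_1-1$. Moreover, the dimension of the space of sections defining them is $$h^0\left(X,\Theta_X\otimes i^{*}\mathcal{O}_{\mathbb{P}^3}(d-1)\right)=\begin{cases}T(d,d_1)+1,&\text{if } d=-3+2d_1,\\ T(d,d_1),&\text{otherwise,}\end{cases}$$ where $$T(d,d_1)=\binom{5+d-d_1}{2}\binom{2+d-d_1}{1}-\binom{5+d-2d_1}{2}\binom{2+d-2d_1}{1}-\binom{6+d-2d_1}{3}+\binom{6+d-3d_1}{3}.$$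
   Context: $i:X\to\mathbb{P}^3$ is the inclusion and $\Theta_X$ is the tangent sheaf of $X$. A foliation on $X$ with tangent sheaf $\mathscr{L}$ (an invertible sheaf) is the class, modulo nonzero scalars, of a nonzero global section of $\Theta_X\otimes\mathscr{L}^{\vee}$. Binomial coefficients use the convention $\binom{a}{b}=\frac{a!}{b!(a-b)!}$ if $0\le b\le a$, and $\binom{a}{b}=0$ otherwise (in particular $\binom{a}{b}=0$ for negative $a$). $h^0$ denotes the complex dimension of $H^0$. *)

(* Defs.v *)
From mathcomp Require Import all_boot all_order all_algebra.
From mathcomp Require Import complex.
From mathcomp Require Import boolp classical_sets functions reals.
From mathcomp Require Import mpoly.

Set Implicit Arguments.
Unset Strict Implicit.
Unset Printing Implicit Defensive.

Import Order.TTheory GRing.Theory Num.Theory.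
Local Open Scope classical_set_scope.
Local Open Scope ring_scope.

(* Subsets of X = V(f) in P^3 are represented by their cones of homogeneous
   coordinate vectors, and a section of i^*O(e) over U by the corresponding
   function on the cone of U, homogeneous of degree e.  Such functions are
   extended by 0 off the cone of U, so that equality of functions is equality
   of sections; [restr] is the restriction of sections. *)

Section Surface.
Variable R : realType.
Local Notation C := R[i].
Local Notation V := ('I_4 -> C).
Local Notation fct := (V -> C^o).
Local Notation family := (set V -> fct -> fct).

Definition smooth_hypersurface (f : {mpoly C[4]}) (d : nat) : Prop :=
  [/\ f != 0, f \is d.-homog &
      forall v : V, v != 0 -> f.@[v] = 0 -> exists i, (f^`M(i)).@[v] != 0].

Variable f : {mpoly C[4]}.

Definition pts : set V := [set v | v != 0 /\ f.@[v] = 0].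

Definition zopen (U : set V) : Prop :=
  exists2 G : set {mpoly C[4]},
    (forall g, G g -> exists k, g \is k.-homog) &
    U = [set v | pts v /\ exists2 g, G g & g.@[v] != 0].

Definition restr (U : set V) (s : fct) : fct := patch (fun=> 0) U s.

(* Sections of i^*O(e) over U. *)
Definition O_X (e : int) (U : set V) : set fct := [set s |
  (forall v, ~ U v -> s v = 0) /\
  (forall v, U v -> exists W : set V, [/\ zopen W, W v, W `<=` U &
     exists (k l : nat) (p q : {mpoly C[4]}),
       [/\ p \is k.-homog, q \is l.-homog, k%:Z = l%:Z + e &
           forall w, W w -> q.@[w] != 0 /\ s w = p.@[w] / q.@[w]]])].

(* C-linear derivations of sheaves O_X|U -> i^*O(e)|U: families of maps
   D W : O_X(W) -> i^*O(e)(W), for W open in U, compatible with restrictions.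
   D W s is set to 0 where it is meaningless, so that two derivations are equal
   exactly when they are equal as terms. *)
Definition derivations (e : int) (U : set V) : set family := [set D |
  [/\ forall W s, zopen W -> W `<=` U -> O_X 0 W s -> O_X e W (D W s),
      forall W W' s, zopen W -> zopen W' -> W' `<=` W -> W `<=` U ->
        O_X 0 W s -> D W' (restr W' s) = restr W' (D W s),
      forall W (a : C) s t, zopen W -> W `<=` U -> O_X 0 W s -> O_X 0 W t ->
        D W (a *: s + t) = a *: D W s + D W t,
      forall W s t, zopen W -> W `<=` U -> O_X 0 W s -> O_X 0 W t ->
        D W (s \* t) = s \* D W t + t \* D W s &
      forall W s, ~ [/\ zopen W, W `<=` U & O_X 0 W s] -> D W s = 0]].

Definition Theta (U : set V) : set family := derivations 0 U.

(* Sections over U of Theta_X (x) i^*O(e).  As i^*O(e) is invertible,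
   theta (x) g |-> (s |-> g theta(s)) embeds this tensor product in the sheaf
   of derivations from O_X to i^*O(e); its sections are the derivations that
   are locally finite sums of such elementary tensors. *)
Definition Theta_twist (e : int) (U : set V) : set family := [set D |
  derivations e U D /\
  forall v, U v -> exists U' : set V, [/\ zopen U', U' v, U' `<=` U &
    exists (n : nat) (theta : 'I_n -> family) (g : 'I_n -> fct),
      [/\ forall k, Theta U' (theta k), forall k, O_X e U' (g k) &
          forall W s, zopen W -> W `<=` U' -> O_X 0 W s ->
            D W s = \sum_k (g k \* theta k W s)]]].

Definition H0_Theta (e : int) : set family := Theta_twist e pts.

(* Foliations with tangent sheaf i^*O(e), whose dual is i^*O(-e). *)
Definition foliations (e : int) : set (set family) := [set F |
  exists2 D, H0_Theta (- e) D /\ D <> 0 &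
    F = [set a *: D | a in [set a : C | a != 0]]].

End Surface.

Definition has_dim (K : fieldType) (M : lmodType K) (S : set M) (n : nat) :
  Prop := exists phi : {linear 'rV[K]_n -> M}, injective phi /\ range phi = S.

Definition binz (a : int) (b : nat) : int :=
  if a is Posz n then 'C(n, b)%:Z else 0.

Definition T (d d1 : int) : int :=
  binz (5 + d - d1) 2 * binz (2 + d - d1) 1
  - binz (5 + d - 2 * d1) 2 * binz (2 + d - 2 * d1) 1
  - binz (6 + d - 2 * d1) 3 + binz (6 + d - 3 * d1) 3.

(* Main.v *)
Require Import Defs.
From HB Require Import structures.
From mathcomp Require Import all_boot all_order all_algebra.
From mathcomp Require Import complex.
From mathcomp Require Import boolp classical_sets functions cardinality reals.
From mathcomp Require Import mpoly.
From mathcomp Require Import finmap.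
From mathcomp Require Import ring lra zify.

(** Write P for the polynomial ring in four variables, [S = P / (f)] and [grad f] for
the gradient of [f].  The proof identifies the sections of the twisted tangent
sheaf with pieces of graded modules and counts forms.

A derivation [D] from O_X to O_X(e) is determined by the values [D (x_j / x_i)].
The functions [omega i j = x_i^2 D (x_j / x_i)], which in classical notation are
the coordinates of the bivector [x /\ theta], are defined on all of X and not
only on a chart, so they are classes of forms of degree [e + 2] in S
([global_function], [homogeneous_function], [derivation_form]).  They satisfy
[x /\ omega = 0], and the Koszul complex of the variables over S is exact in
this degree, so that [omega = x /\ a] for a vector [a] of forms of degree [e + 1]
([koszul_cocycle2]).  After adding a multiple of the Euler field one has
[a . grad f = 0], and [D] is the derivation [vfield f a] along [a]
([derivation_is_vfield]).  Conversely each syzygy [a] of the gradient gives such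
a derivation ([vfield_derivation]), on the chart [x_i != 0] a derivation into
O_X(e) is a multiple of a vector field ([Theta_twistE]), and [vfield f a = 0]
exactly when [a = c x + f w] ([vfield_eq0P]).  Hence the space of sections is

  { a in P_(e+1)^4 : a . grad f = 0 } / { c x + f w : (c x + f w) . grad f = 0 }.

Smoothness says that the partial derivatives have no common zero besides the
origin, so by the Nullstellensatz their ideal contains powers of all variables
([powers_in_gradient]).  Powers of the variables form a regular sequence, and a
Koszul complex is exact in the ranks below the length of a regular sequence in the
ideal of its elements ([koszul_exact]).  The syzygies of degree [d] are therefore
counted by [6 N(d-m) - 4 N(d-2m) + N(d-3m)] with [m = d1 - 1] and N(k)
the number of monomials of degree k ([has_dim_syzygies], [cocycle_dim3]).  The
denominator is the image of [radial], whose kernel consists of the multiples of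
the Euler field, so it has dimension [4 N(d-d1) - N(d-d1-1)] ([has_dim_H0]).  The
difference is T(d, d1), except for d = 2 d1 - 3, where the closed formula subtracts 1
for a space of forms that is zero ([count_second]).

Sections are functions on the cone of X, so one also needs that a polynomial
vanishing on X is a multiple of f ([vanishing_multiple]).  That the ideal (f) is
radical is again deduced from the exactness of Koszul complexes, without
factoring f: if f divides u^2, then f^k divides u^(k+1) for all k
([square_divisible_powers]), and comparing degrees along a line that meets X
properly shows that f divides u ([square_radical]).

For d < d1 - 1 all the numbers above vanish.  For d >= d1 - 1 a multiple of one of
the fields [f_j d_i - f_i d_j] is nonzero ([nonzero_vfield]). *)

Set Implicit Arguments.
Unset Strict Implicit.
Unset Printing Implicit Defensive.

Import Order.TTheory GRing.Theory Num.Theory.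
Local Open Scope classical_set_scope.
Local Open Scope ring_scope.

(** * Exactness of Koszul complexes *)

Definition is_ideal (A : comNzRingType) (J : set A) : Prop :=
  [/\ J 0, forall a b, J a -> J b -> J (a + b) & forall a b, J b -> J (a * b)].

Section Ideal.
Variables (A : comNzRingType) (J : set A).
Hypothesis hJ : is_ideal J.

Lemma ideal0 : J 0. Proof. by case: hJ. Qed.
Lemma idealD a b : J a -> J b -> J (a + b). Proof. by case: hJ => _ h _; apply: h. Qed.
Lemma idealM a b : J b -> J (a * b). Proof. by case: hJ => _ _; apply. Qed.
Lemma ideal_mulr a b : J b -> J (b * a). Proof. by rewrite mulrC; apply: idealM. Qed.
Lemma idealN a : J a -> J (- a). Proof. by rewrite -mulN1r; apply: idealM. Qed.
Lemma idealB a b : J a -> J b -> J (a - b).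
Proof. by move=> ha /idealN; apply: idealD. Qed.
Lemma ideal_sum (I : Type) (r : seq I) (P : pred I) (F : I -> A) :
  (forall i, P i -> J (F i)) -> J (\sum_(i <- r | P i) F i).
Proof. by move=> h; elim/big_ind: _ => //; [exact: ideal0 | exact: idealD]. Qed.
End Ideal.

Lemma is_ideal0 (A : comNzRingType) : is_ideal [set 0 : A].
Proof. by split=> //= a b; [move=> -> ->; rewrite addr0 | move=> ->; rewrite mulr0]. Qed.

Section KoszulExactness.
Variables (A : comNzRingType) (X : Type) (rk : X -> nat).
Local Notation cochain := (X -> A).

Definition ideal_valued (J : set A) (r : nat) (u : cochain) : Prop :=
  forall t, rk t = r -> J (u t).

Variable d : cochain -> cochain.

(** Cochains are arbitrary functions of an index that has a rank.  The last clause
says that [d u] in rank [r.+1] depends linearly on [u] in rank [r]; it is phrased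
with ideals because the complex is used modulo ideals without forming quotient
rings. *)
Definition differential : Prop :=
  [/\ forall u v t, d (fun t => u t - v t) t = d u t - d v t,
      forall a u t, d (fun t => a * u t) t = a * d u t,
      forall u t, d (d u) t = 0,
      forall u t, rk t = 0%N -> d u t = 0 &
      forall J r u, is_ideal J -> ideal_valued J r u -> ideal_valued J r.+1 (d u)].

(** The maps [d] and [h] satisfy [d h + h d = y], so [y] annihilates the cohomology;
for a Koszul complex any [y] in the ideal of its elements has such an [h], the
contraction by the coefficients of [y]. *)
Definition homotopy (y : A) (h : cochain -> cochain) : Prop :=
  (forall u t, d (h u) t + h (d u) t = y * u t) /\
  (forall J r u, is_ideal J -> ideal_valued J r.+1 u -> ideal_valued J r (h u)).

Variables (N : nat) (J : nat -> set A) (y : nat -> A).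

(** The [y k] form a regular sequence, and [J k] is the ideal of the first [k] of them. *)
Definition regular_chain : Prop := forall k, (k < N)%N ->
  [/\ is_ideal (J k), forall a, J k (y k * a) -> J k a &
      forall a, J k.+1 a <-> exists b c, J k b /\ a = b + y k * c].

Hypotheses (hd : differential) (hJ : regular_chain).
Hypothesis hy : forall k, (k < N)%N -> exists h, homotopy (y k) h.

(** Modulo [J k] the homotopy gives [y k u = d (h u)], so [h u] is a cocycle modulo
[J k.+1], in rank one less.  By induction [h u = d w + y k c], hence
[y k u = y k d c], and [y k] can be cancelled.  Each step down in rank uses one
more element of the regular sequence. *)
Lemma koszul_exact k r u : (k + r < N)%N -> ideal_valued (J k) r.+1 (d u) ->
  exists w, ideal_valued (J k) r (fun t => u t - d w t).
Proof.
case: hd => dB dZ dd d0 dJ.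
elim: r k u => [|r IH] k u hk hu.
  have kN : (k < N)%N by rewrite addn0 in hk.
  have [Jk regk _] := hJ kN; have [h [hh hhJ]] := hy kN.
  exists u => t ht; rewrite (d0 u t ht) subr0; apply: regk.
  by rewrite -hh (d0 _ t ht) add0r; exact: (hhJ (J k) 0%N).
have kN : (k < N)%N by apply: leq_ltn_trans hk; apply: leq_addr.
have [Jk regk J1] := hJ kN; have [h [hh hhJ]] := hy kN.
have hv t : rk t = r.+1 -> J k (y k * u t - d (h u) t).
  by move=> ht; rewrite -hh addrC addKr; exact: (hhJ _ r.+1).
have [||w hw] := IH k.+1 (h u); first by rewrite addSnnS.
  move=> t ht; apply/J1; exists (- (y k * u t - d (h u) t)), (u t); split.
    by apply: idealN => //; exact: hv.
  by rewrite opprB subrK.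
have /choice[c hc] t : exists c, rk t = r -> J k (h u t - d w t - y k * c).
  have [ht|nt] := pselect (rk t = r); last by exists 0.
  by have /J1[b [c [hb ->]]] := hw _ ht; exists c => _; rewrite addrK.
exists c => t ht; apply: regk.
have := dJ _ _ _ Jk hc _ ht; rewrite dB dB dd dZ subr0 => h2.
by rewrite mulrBr -[y k * u t](subrK (d (h u) t)) -addrA; apply: idealD => //; exact: hv.
Qed.

End KoszulExactness.

Section KoszulModulo.
Variables (A : idomainType) (X : Type) (rk : X -> nat).
Variables (d : (X -> A) -> X -> A) (N : nat) (J : nat -> set A) (y : nat -> A).
Hypotheses (hd : differential rk d) (hJ : regular_chain N J y).
Hypothesis (J0 : J 0%N = [set 0]).
Hypothesis hy : forall k, (k < N)%N -> exists h, homotopy rk d (y k) h.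

Definition multiples (f : A) : set A := [set a | exists b, a = f * b].

Lemma multiples_ideal f : is_ideal (multiples f).
Proof.
split=> [|_ _ [a ->] [b ->]|a _ [b ->]]; first by exists 0; rewrite mulr0.
  by exists (a + b); rewrite mulrDr.
by exists (a * b); rewrite mulrCA.
Qed.

Lemma koszul_exact0 r u : (r < N)%N -> (forall t, rk t = r.+1 -> d u t = 0) ->
  exists w, forall t, rk t = r -> u t = d w t.
Proof.
move=> hr hu; have [|w hw] := koszul_exact hd hJ hy (k := 0%N) (u := u) hr.
  by move=> t ht; rewrite J0 /=; exact: hu.
by exists w => t /hw; rewrite J0 /= => /subr0_eq.
Qed.

(** One rank is lost by passing to the quotient by [f]: from [d u = f q] one gets
[d q = 0], so [q = d w], and [u - f w] is an honest cocycle. *)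
Lemma koszul_exact_mod f r u : f != 0 -> (r.+1 < N)%N ->
  ideal_valued rk (multiples f) r.+1 (d u) ->
  exists w, ideal_valued rk (multiples f) r (fun t => u t - d w t).
Proof.
move=> f0 hr hu; case: (hd) => dB dZ dd d0 dJ.
have /choice[q hq] t : exists q, rk t = r.+1 -> d u t = f * q.
  have [ht|nt] := pselect (rk t = r.+1); last by exists 0.
  by have [q hq] := hu _ ht; exists q.
have [|w hw] := koszul_exact0 (u := q) hr.
  move=> t ht; apply: (mulfI f0); rewrite mulr0 -dZ.
  have /= := dJ [set 0] r.+1 (fun t => f * q t - d u t) (is_ideal0 A) _ t ht.
  rewrite dB dd subr0; apply=> s hs /=; rewrite hq // subrr //.
have [|w' hw'] := koszul_exact0 (u := fun t => u t - f * w t) (ltnW hr).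
  by move=> t ht; rewrite dB dZ hq // hw // subrr.
by exists w' => t ht; exists (w t); rewrite -hw' // opprB addrC subrK.
Qed.

End KoszulModulo.

Section OrderedKoszul.
Variables (A : comNzRingType) (I : finType) (g : I -> A).

(** The Koszul differential [g /\ _] on all functions of sequences of indices,
alternating or not.  The recursion on the sequence makes [d d = 0] and the homotopy
formula immediate, which would require bookkeeping of signs on the exterior
algebra; the alternating version [skoszul] serves only for counting. *)
Fixpoint okoszul (u : seq I -> A) (s : seq I) : A :=
  if s is i :: s' then g i * u s' - okoszul (fun t => u (i :: t)) s' else 0.

Definition ocontract (c : I -> A) (u : seq I -> A) (s : seq I) : A :=
  \sum_i c i * u (i :: s).

Lemma okoszul_sum (T : Type) (r : seq T) (c : T -> A) (u : T -> seq I -> A) s :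
  okoszul (fun t => \sum_(i <- r) c i * u i t) s =
  \sum_(i <- r) c i * okoszul (u i) s.
Proof.
elim: s u => /= [|j s IH] u; first by rewrite big1 // => i _; rewrite mulr0.
rewrite IH mulr_sumr -sumrB; apply: eq_bigr => i _; rewrite mulrBr mulrCA //.
Qed.

Lemma okoszulB u v s :
  okoszul (fun t => u t - v t) s = okoszul u s - okoszul v s.
Proof.
elim: s u v => /= [|i s IH] u v; first by rewrite subr0.
by rewrite IH; ring.
Qed.

Lemma okoszulZ a u s : okoszul (fun t => a * u t) s = a * okoszul u s.
Proof. by elim: s u => /= [|i s IH] u; rewrite ?mulr0 // IH; ring. Qed.

Lemma okoszul_differential : differential size okoszul.
Proof.
split; [exact: okoszulB | exact: okoszulZ | | by move=> u [] | ].
- move=> u s; elim: s u => //= i s IH u.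
  by rewrite okoszulB okoszulZ IH subr0 subrr.
- move=> J r u hJ hu s; elim: s r u hu => //= i s IH r u hu [hs].
  apply: idealB => //; first by apply: idealM => //; exact: hu.
  case: r hu hs => [|r] hu hs; first by case: s hs {IH} => //= _; exact: ideal0.
  by apply: (IH r) => // t ht; apply: hu; rewrite /= ht.
Qed.

Lemma ocontract_homotopy c :
  homotopy size okoszul (\sum_i c i * g i) (ocontract c).
Proof.
split=> [u s|J r u hJ hu s hs]; last first.
  by apply: ideal_sum => // i _; apply: idealM => //; apply: hu; rewrite /= hs.
rewrite /ocontract okoszul_sum -big_split /= mulr_suml; apply: eq_bigr => i _.
by rewrite -mulrDr addrC subrK mulrA.
Qed.

End OrderedKoszul.

(** * The Koszul complex on the exterior algebra *)

Section SetKoszul.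
Variables (A : comNzRingType) (n : nat) (g : 'I_n -> A).
Local Notation cochain := ({set 'I_n} -> A).

(** The sign of moving [e_i] to its place in the exterior product of the [e_j], [j] in
[S], taken in increasing order. *)
Definition ksgn (i : 'I_n) (S : {set 'I_n}) : A :=
  (-1) ^+ #|[set j in S | (j < i)%N]|.

Definition skoszul (u : cochain) (S : {set 'I_n}) : A :=
  \sum_(i in S) ksgn i S * g i * u (S :\ i).

Definition scontract (c : 'I_n -> A) (u : cochain) (S : {set 'I_n}) : A :=
  \sum_(i | i \notin S) ksgn i S * c i * u (i |: S).

Lemma ksgn_sqr i (S : {set 'I_n}) : ksgn i S * ksgn i S = 1.
Proof. by rewrite -exprD addnn -mul2n exprM sqrrN !expr1n. Qed.

Lemma ksgn_del i j (S : {set 'I_n}) : j \in S -> ksgn i S = (-1) ^+ (j < i)%N * ksgn i (S :\ j).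
Proof.
move=> jS; rewrite /ksgn -exprD; congr (_ ^+ _).
rewrite (cardsD1 j) !inE jS /=; congr addn.
by apply: eq_card => k; rewrite !inE andbA.
Qed.

Lemma ksgn_delE i j (S : {set 'I_n}) : j \in S -> ksgn i (S :\ j) = (-1) ^+ (j < i)%N * ksgn i S.
Proof. by move=> jS; rewrite (ksgn_del i jS) signrMK. Qed.

Lemma ksgn_add i j (S : {set 'I_n}) : j \notin S -> ksgn i (j |: S) = (-1) ^+ (j < i)%N * ksgn i S.
Proof. by move=> jS; rewrite (ksgn_del i (finset.setU11 j S)) finset.setU1K. Qed.

(** In [d (d u)] the two ways of removing [i] and [j] from [S] have opposite signs. *)
Lemma skoszul_differential : differential (fun S : {set 'I_n} => #|S|) skoszul.
Proof.
split=> [u v S|a u S|u S|u S /eqP|J r u hJ hu S hS].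
- by rewrite /skoszul -sumrB; apply: eq_bigr => i _; rewrite mulrBr.
- by rewrite /skoszul mulr_sumr; apply: eq_bigr => i _; rewrite mulrCA.
- rewrite /skoszul.
  pose F i j := ksgn i S * g i * (ksgn j (S :\ i) * g j * u (S :\ i :\ j)).
  have FN i j : i \in S -> j \in S -> i != j -> F i j = - F j i.
    move=> iS jS ij; rewrite /F !ksgn_delE //.
    have -> : S :\ j :\ i = S :\ i :\ j by apply/setP=> k; rewrite !inE andbCA.
    move: ij; rewrite -val_eqE neq_ltn => /orP[] ij; rewrite ij ltnNge (ltnW ij) /=; ring.
  rewrite (eq_bigr (fun i => \sum_(j in S :\ i) F i j)); last first.
    by move=> i _; rewrite mulr_sumr.
  rewrite (eq_bigr (fun i : 'I_n =>
    \sum_(j in S | (j < i)%N) F i j - \sum_(j in S | (i < j)%N) F j i)).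
    rewrite sumrB (exchange_big_dep (mem S)) /=; last by move=> i j _ /andP[].
    apply/eqP; rewrite subr_eq0; apply/eqP/eq_bigr => i iS.
    by apply: eq_bigl => j; rewrite ?iS andbC.
  move=> i iS; rewrite (bigID (fun j : 'I_n => (j < i)%N)) /=; congr (_ + _).
    apply: eq_bigl => j; rewrite !inE -andbA; case: (j \in S); rewrite ?andbF //=.
    by rewrite -val_eqE neq_ltn; case: ltngtP.
  rewrite -sumrN; apply: eq_big => [j|j /andP[]].
    rewrite !inE -andbA; case: (j \in S); rewrite ?andbF //=.
    by rewrite -val_eqE neq_ltn; case: ltngtP.
  by rewrite !inE => /andP[ji jS] _; rewrite FN // eq_sym.
- by rewrite cards_eq0 => /eqP ->; rewrite /skoszul big_set0.
- apply: ideal_sum => // i iS; apply: idealM => //; apply: hu.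
  by move: hS; rewrite (cardsD1 i) iS => -[].
Qed.

(** Removing [i] and adding [j] in either order gives opposite signs when [i != j]; the
terms with [i = j] add up to the sum of the [c i * g i], those with [i] in [S] coming
from [d h] and the others from [h d]. *)
Lemma scontract_homotopy c :
  homotopy (fun S : {set 'I_n} => #|S|) skoszul (\sum_i c i * g i) (scontract c).
Proof.
split=> [u S|J r u hJ hu S hS]; last first.
  apply: ideal_sum => // i iS; apply: idealM => //; apply: hu.
  by rewrite cardsU1 iS hS.
rewrite /skoszul /scontract.
pose F i j := ksgn i S * g i * (ksgn j (S :\ i) * c j * u (j |: (S :\ i))).
rewrite (eq_bigr (fun i => c i * g i * u S + \sum_(j | j \notin S) F i j)); last first.
  move=> i iS; rewrite (bigD1 i) /= ?finset.setD11 // finset.setD1K //.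
  rewrite ksgn_delE // ltnn mul1r mulrDr.
  rewrite (_ : ksgn i S * g i * (ksgn i S * c i * u S) =
    ksgn i S * ksgn i S * (c i * g i * u S)); last by ring.
  rewrite ksgn_sqr mul1r mulr_sumr; congr (_ + _); apply: eq_bigl => j.
  by rewrite !inE negb_and negbK; case: eqVneq => [->|]; rewrite ?iS ?andbF ?andbT.
rewrite [X in _ + X](eq_bigr (fun j => c j * g j * u S - \sum_(i in S) F i j)); last first.
  move=> j jS; rewrite (bigD1 j) /= ?finset.setU11 // finset.setU1K //.
  rewrite ksgn_add // ltnn mul1r mulrDr.
  rewrite (_ : ksgn j S * c j * (ksgn j S * g j * u S) =
    ksgn j S * ksgn j S * (c j * g j * u S)); last by ring.
  rewrite ksgn_sqr mul1r mulr_sumr; congr (_ + _); rewrite -sumrN; apply: eq_big => [i|i].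
    by rewrite !inE; case: eqVneq => [->|]; rewrite ?(negbTE jS) ?andbF ?andbT.
  rewrite !inE => /andP[]; case: eqVneq => //= ij iS _.
  rewrite /F ksgn_add // ksgn_delE //.
  have -> : (j |: S) :\ i = j |: (S :\ i).
    by apply/setP=> k; rewrite !inE; case: eqVneq => // ->; rewrite (negbTE ij).
  move: ij; rewrite -val_eqE neq_ltn => /orP[] ij; rewrite ij ltnNge (ltnW ij) /=; ring.
rewrite !big_split /= sumrN (exchange_big_dep (fun j => j \notin S)) //=.
rewrite [X in _ + X + _](_ : _ = \sum_(j | j \notin S) \sum_(i in S) F i j).
  rewrite addrACA subrr addr0 mulr_suml.
  by rewrite [RHS](bigID (mem S)) /=; congr (_ + _).
by apply: eq_bigr => j jS; apply: eq_bigl => i; rewrite jS andbT.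
Qed.

End SetKoszul.

(** * The regular sequence of powers of the variables *)

Section PowersOfVariables.
Variables (K : idomainType) (n e : nat).
Local Notation P := {mpoly K[n.+1]}.

Definition xpow (k : nat) : P := 'X_(inord k) ^+ e.

(** The ideal generated by the [e]-th powers of the first [k] variables, described by
its monomials. *)
Definition xpow_ideal (k : nat) : set P :=
  [set p | forall m, m \in msupp p -> exists2 i : 'I_n.+1, (i < k)%N & (e <= m i)%N].

Lemma xpow_ideal0 : xpow_ideal 0 = [set 0].
Proof.
apply/seteqP; split=> [p hp|_ -> m] /=; last by rewrite msupp0.
by apply/mpolyP=> m; apply/eqP; rewrite mcoeff0 mcoeff_eq0; apply/negP => /hp[].
Qed.

Lemma xpow_chain : regular_chain n.+1 xpow_ideal xpow.
Proof.
have xE k : xpow k = 'X_[U_(inord k) *+ e] by rewrite /xpow mpolyXn.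
move=> k kn; have vk : (inord k : 'I_n.+1) = k :> nat by rewrite inordK.
have hI j : is_ideal (xpow_ideal j).
  split=> [m|a b ha hb m|a b hb m]; first by rewrite msupp0.
    by move/msuppD_le; rewrite mem_cat => /orP[/ha|/hb].
  move/msuppM_le => /allpairsP[[m1 m2] /= [_ /hb[i ik ei] ->]].
  by exists i => //; rewrite mnmDE; apply: leq_trans ei (leq_addl _ _).
split; first exact: hI.
  move=> a ha m.
  rewrite mcoeff_msupp => am.
  have [|i ik] := ha (U_(inord k) *+ e + m)%MM.
    by rewrite mcoeff_msupp xE mulrC addmC addmC mcoeffMX.
  rewrite mnmDE mulmnE mnm1E -val_eqE /= vk gtn_eqF // mul0n add0n.
  by exists i.
move=> a; split=> [ha|[b [c [hb ->]]] m]; last first.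
  move/msuppD_le; rewrite mem_cat => /orP[/hb[i ik ei]|].
    by exists i => //; apply: ltnW.
  rewrite mulrC xE (perm_mem (msuppMX _ _)) => /mapP[m' _ ->].
  by exists (inord k); rewrite ?vk // mnmDE mulmnE mnm1E eqxx mul1n leq_addr.
pose Q (m : 'X_{1..n.+1}) := (e <= m (inord k))%N.
exists (\sum_(m <- msupp a | ~~ Q m) a@_m *: 'X_[m]),
       (\sum_(m <- msupp a | Q m) a@_m *: 'X_[m - U_(inord k) *+ e]); split; last first.
  rewrite [LHS]mpolyE (bigID Q) /= addrC; congr (_ + _).
  rewrite mulr_sumr; apply: eq_bigr => m Qm.
  rewrite -scalerAr xE -mpolyXD addmC submK //.
  apply/mnm_lepP => i; rewrite mulmnE mnm1E.
  by case: eqVneq => [<-|]; rewrite ?mul1n.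
rewrite big_seq_cond; apply: ideal_sum => [|m /andP[/ha[i ik ei] Qm]]; first exact: hI.
have ik' : (i < k)%N.
  move: ik; rewrite ltnS leq_eqVlt => /orP[/eqP ik|//].
  by case/negP: Qm; rewrite /Q -ik inord_val.
by move=> m' /msuppZ_le; rewrite msuppX inE => /eqP ->; exists i.
Qed.

End PowersOfVariables.

(** * The Nullstellensatz over an uncountable field *)

Lemma mpoly_ring_ind (R : comNzRingType) n (Q : {mpoly R[n]} -> Prop) :
  (forall c, Q c%:MP) -> (forall i, Q 'X_i) ->
  (forall p q, Q p -> Q q -> Q (p + q)) -> (forall p q, Q p -> Q q -> Q (p * q)) ->
  forall p, Q p.
Proof.
move=> QC QX QD QM; apply: mpolyind => [|c m p _ _ Qp]; first by rewrite -mpolyC0.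
apply: (QD) => //; rewrite -mul_mpolyC; apply: (QM) => //; rewrite mpolyXE_id.
apply: (big_ind Q) => [||i _]; [by rewrite -mpolyC1 | exact: QM |].
move: (m i : nat); elim=> [|k IH]; first by rewrite expr0 -mpolyC1.
by rewrite exprS; apply: QM.
Qed.

Lemma finite_dependency (K : fieldType) n D (T : finType) (g : T -> {mpoly K[n]}) :
  (forall t, (msize (g t) <= D)%N) -> (#|{: 'X_{1..n < D}}| < #|T|)%N ->
  exists2 l : T -> K, (exists t, l t != 0) & \sum_t l t *: g t = 0.
Proof.
move=> gD hT.
pose U := {: 'X_{1..n < D}}%type.
pose A : 'M[K]_(#|T|, #|U|) :=
  \matrix_(i, j) (g (enum_val i : T))@_(bmnm (enum_val j : 'X_{1..n < D})).

have kA : kermx A != 0.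
  rewrite kermx_eq0 /row_free neq_ltn; apply/orP; left.
  exact: leq_ltn_trans (rank_leq_col A) hT.
pose l := nz_row (kermx A).
have l0 : l != 0 by rewrite nz_row_eq0.
have lA : l *m A = 0 by apply/sub_kermxP/nz_row_sub.
exists (fun t => l 0 (enum_rank t)).
  have /rV0Pn[i li] := l0; exists (enum_val i); by rewrite enum_valK.
apply/mpolyP=> m; rewrite mcoeff0 raddf_sum /=.
have [mD|Dm] := ltnP (mdeg m) D; last first.
  apply: big1 => t _; rewrite mcoeffZ.
  have /msize_mdeg_ge : (msize (g t) <= mdeg m)%N by apply: leq_trans Dm.
  by rewrite -mcoeff_eq0 => /eqP ->; rewrite mulr0.
have := congr1 (fun M : 'rV_ _ => M 0 (enum_rank (BMultinom mD))) lA.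
rewrite !mxE => E; rewrite -[RHS]E {E} (reindex (@enum_val T predT)) /=; last first.
  by exists enum_rank => x _; rewrite ?enum_valK ?enum_rankK.
by apply: eq_bigr => i _; rewrite mcoeffZ !mxE enum_rankK enum_valK.
Qed.

Section Nullstellensatz.
Variables (K : closedFieldType) (n : nat).
Hypothesis uncK : ~ countable [set: K].
Local Notation P := {mpoly K[n]}.

Section Maximal.
Variables (M : set P) (h : P).
Hypotheses (hM : is_ideal M) (hMh : forall k, ~ M (h ^+ k)).
Hypothesis maxM : forall M', is_ideal M' -> M `<=` M' -> ~ M' `<=` M ->
  exists k, M' (h ^+ k).

(** Otherwise the ideal generated by [M] and [u] would avoid the powers of [h]. *)
Lemma maximal_adjoin u : ~ M u -> exists k g, M (h ^+ k - g * u).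
Proof.
move=> Mu; have [||| k [b [g [hb hk]]]] :=
    maxM (M' := [set a | exists b c, M b /\ a = b + c * u]).
- split=> [|_ _ [b [c [hb ->]]] [b' [c' [hb' ->]]]|a _ [b [c [hb ->]]]].
  + by exists 0, 0; rewrite mul0r addr0; split=> //; exact: (ideal0 hM).
  + by exists (b + b'), (c + c'); split; [exact: idealD | ring].
  + by exists (a * b), (a * c); split; [exact: idealM | ring].
- by move=> a ha; exists a, 0; rewrite mul0r addr0.
- move=> M'M; apply: Mu; apply: M'M.
  by exists 0, 1; rewrite mul1r add0r; split=> //; exact: (ideal0 hM).
by exists k, g; rewrite hk addrK.
Qed.

Lemma maximal_prime u v : M (u * v) -> M u \/ M v.
Proof.
move=> Muv; have [|/maximal_adjoin[k [g hk]]] := pselect (M u); first by left.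
have [|/maximal_adjoin[l [g' hl]]] := pselect (M v); first by right.
case: (hMh (k := (k + l)%N)); rewrite exprD.
have -> : h ^+ k * h ^+ l = h ^+ k * (h ^+ l - g' * v) + g' * v * (h ^+ k - g * u)
  + g * g' * (u * v) by ring.
by apply: idealD => //; [apply: idealD => //|]; apply: idealM.
Qed.

(** If no ['X_j - a] is in [M], each of them has an inverse modulo [M], up to a power of
[h].  As [K] is uncountable, infinitely many of these inverses come with the same
power and the same bound on their degree, so they are linearly dependent.
Clearing denominators in a linear relation yields a polynomial [H != 0] in one
variable with [H ('X_j)] in [M], and [M] is prime. *)
Lemma maximal_root j : exists c, M ('X_j - c%:MP).
Proof.
apply: contrapT => nex.
have /choice[kg hkg] (a : K) : exists kg : nat * P, M (h ^+ kg.1 - kg.2 * ('X_j - a%:MP)).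
  have [|k [g hk]] := @maximal_adjoin ('X_j - a%:MP).
    by move=> Ma; apply: nex; exists a.
  by exists (k, g).
(* The [a] that share the exponent of [h] and the bound on the degree. *)
pose F (kD : nat * nat) : set K := [set a | (kg a).1 = kD.1 /\ (msize (kg a).2 <= kD.2)%N].
have [[k D] infF] : exists kD, infinite_set (F kD).
  apply: contrapT => fin; apply: uncK.
  rewrite (_ : [set: K] = \bigcup_(kD in [set: nat * nat]) F kD).
    apply: bigcup_countable => // kD _; apply: finite_set_countable.
    by apply: contrapT => inf; apply: fin; exists kD.
  apply/seteqP; split=> // a _; exists ((kg a).1, msize (kg a).2) => //.
have [B BF cB] := infinite_set_fset #|{: 'X_{1..n < D}}|.+1 infF.
have [||l [t0 l0] hl] := @finite_dependency K n D B (fun b => (kg (val b)).2).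
- by move=> t; case: (BF _ (valP t)).
- by rewrite cardfE in cB.
(* The relation after multiplication by all the [X - t], [t] in [B]. *)
pose H : {poly K} := \sum_(t : B) l t *: \prod_(s : B | s != t) ('X - (val s)%:P).
have H0 : H != 0.
  apply/eqP => /(congr1 (fun p => p.[val t0])); rewrite horner0 horner_sum.
  rewrite (bigD1 t0) //= [X in _ + X]big1 ?addr0 => [/eqP|t tt0]; last first.
    rewrite hornerZ horner_prod (bigD1 t0) 1?eq_sym //= hornerXsubC subrr.
    by rewrite mul0r mulr0.
  rewrite hornerZ mulf_eq0 (negbTE l0) /= horner_prod => /eqP/eqP.
  rewrite prodf_seq_eq0 => /hasP[s _ /andP[st]]; rewrite hornerXsubC subr_eq0.
  by move/eqP/val_inj => st'; rewrite st' eqxx in st.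
pose phi (p : {poly K}) : P := (map_poly (@mpolyC n K) p).['X_j].
have phiX a : phi ('X - a%:P) = 'X_j - a%:MP.
  by rewrite /phi rmorphB /= map_polyX map_polyC /= hornerXsubC.
have phiprod (I : Type) (r : seq I) (Q : pred I) (a : I -> K) :
    phi (\prod_(i <- r | Q i) ('X - (a i)%:P)) = \prod_(i <- r | Q i) ('X_j - (a i)%:MP).
  by rewrite /phi rmorph_prod horner_prod; apply: eq_bigr => i _; rewrite -phiX.
have phiZ a p : phi (a *: p) = a%:MP * phi p by rewrite /phi map_polyZ hornerZ.
have MH : M (phi H * h ^+ k).
  pose W := \prod_(s : B) ('X_j - (val s)%:MP) : P.
  have -> : phi H * h ^+ k =
      \sum_(t : B) (l t)%:MP * (\prod_(s : B | s != t) ('X_j - (val s)%:MP)) *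
     (h ^+ k - (kg (val t)).2 * ('X_j - (val t)%:MP)) + W * \sum_(t : B) l t *: (kg (val t)).2.
    rewrite {1}/phi /H rmorph_sum horner_sum mulr_suml mulr_sumr -big_split /=.
    apply: eq_bigr => t _; rewrite -/(phi _) phiZ phiprod.
    have -> : W = ('X_j - (val t)%:MP) * \prod_(s : B | s != t) ('X_j - (val s)%:MP).
      by rewrite /W (bigD1 t).
    rewrite -[l t *: _]mul_mpolyC; ring.
  rewrite hl mulr0 addr0; apply: ideal_sum => // t _; apply: idealM => //.
  by have [/= kt _] := BF _ (valP t); rewrite -kt; exact: hkg.
have [r Hr] := closed_field_poly_normal H.
have Mu c : c != 0 -> ~ M c%:MP.
  move=> c0 Mc; apply: (@hMh 0%N).
  have -> : h ^+ 0 = (c^-1)%:MP * c%:MP by rewrite -mpolyCM mulVf.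
  exact: idealM.
have : M (phi H) by case: (maximal_prime MH) => // /hMh.
rewrite Hr phiZ => /maximal_prime[/Mu|].
  by rewrite lead_coef_eq0 => /(_ H0).
rewrite phiprod; elim: r {Hr} => [|z r IH].
  by rewrite big_nil -mpolyC1 => /(Mu _ (oner_neq0 K)).
by rewrite big_cons => /maximal_prime[hz|//]; apply: nex; exists z.
Qed.

End Maximal.

(** An ideal that is maximal among those containing [I] and no power of [h] contains
['X_j - c_j] for some point [c]; then [c] is a zero of [I] but not of [h]. *)
Theorem nullstellensatz (I : set P) (h : P) : is_ideal I ->
  (forall v, (forall p, I p -> p.@[v] = 0) -> h.@[v] = 0) -> exists k, I (h ^+ k).
Proof.
move=> hI hh; apply: contrapT => nI.
pose Q (M : set P) := is_ideal M /\ forall k, ~ M (h ^+ k).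
have [|A [[hM Mh] Amax]] := @Zorn_bigcup _ [set X | Q (I `|` X)].
  move=> F FQ Ftot /=.
  have [F0|/set0P[X0 FX0]] := eqVneq F set0.
    rewrite F0 bigcup_set0 classical_sets.setU0; split=> // k Ik; apply: nI; by exists k.
  have mono X a : F X -> (I `|` X) a -> (I `|` \bigcup_(X in F) X) a.
    by move=> FX [Ia|Xa]; [left | right; exists X].
  have sub a : (I `|` \bigcup_(X in F) X) a -> exists2 X, F X & (I `|` X) a.
    by move=> [Ia|[X FX Xa]]; [exists X0 => //; left | exists X => //; right].
  split; last by move=> k /sub[X /FQ[_ hX] /hX].
  split=> [|a b /sub[X FX Xa] /sub[Y FY Yb]|a b /sub[X FX Xb]].
  - by left; exact: ideal0.
  - have [XY|YX] := Ftot _ _ FX FY.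
      apply: (mono Y) => //; have [hY _] := FQ _ FY; apply: idealD => //.
      by case: Xa => [?|/XY]; [left|right].
    apply: (mono X) => //; have [hX _] := FQ _ FX; apply: idealD => //.
    by case: Yb => [?|/YX]; [left|right].
  - by apply: (mono X) => //; have [hX _] := FQ _ FX; apply: idealM.
set M := I `|` A in hM Mh.
have maxM M' : is_ideal M' -> M `<=` M' -> ~ M' `<=` M -> exists k, M' (h ^+ k).
  move=> hM' MM' nM'; apply: contrapT => nh; apply: (Amax M').
    split=> [a Aa|M'A]; first by apply: MM'; right.
    by apply: nM' => a /M'A; right.
  rewrite /= (_ : I `|` M' = M'); first by split=> // k Mk; apply: nh; exists k.
  by apply/seteqP; split=> [a [Ia|//]|a]; [apply: MM'; left | right].
have /choice[c hc] := maximal_root hM Mh maxM.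
have Mc p : M (p - (p.@[c])%:MP).
  elim/mpoly_ring_ind: p => [a|i|p q hp hq|p q hp hq].
  - by rewrite mevalC subrr; exact: ideal0.
  - by rewrite mevalXU.
  - by rewrite mevalD mpolyCD opprD addrACA; apply: idealD.
  - rewrite mevalM mpolyCM.
    have -> : p * q - (p.@[c])%:MP * (q.@[c])%:MP =
      q * (p - (p.@[c])%:MP) + (p.@[c])%:MP * (q - (q.@[c])%:MP) by ring.
    by apply: idealD => //; apply: idealM.
apply: (@Mh 1%N); rewrite expr1.
suff h0 : h.@[c] = 0 by have := Mc h; rewrite h0 mpolyC0 subr0.
apply: hh => p Ip; apply/eqP/negPn/negP => pc0; apply: (@Mh 0%N).
have -> : h ^+ 0 = ((p.@[c])^-1)%:MP * (p - (p - (p.@[c])%:MP)).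
  by rewrite opprB addrC subrK -mpolyCM mulVf.
by apply: idealM => //; apply: idealB => //; left.
Qed.

End Nullstellensatz.

(** * The complex numbers are uncountable *)

(** Nested intervals: the interval of step [k.+1] is the part of the previous one on
one side of the [k]-th real. *)
Lemma real_uncountable (R : realType) : ~ countable [set: R].
Proof.
move=> /countable_injP[f finj].
pose e (k : nat) : R := xget 0 [set x | f x = k].
have ef x : e (f x) = x.
  rewrite /e; case: xgetP => [y _ /= fy|/(_ x)/(_ erefl)] //.
  by apply: finj; rewrite ?mem_set.
pose step (ab : R * R) (x : R) : R * R :=
  if x <= (ab.1 + ab.2) / 2 then ((ab.1 + 2 * ab.2) / 3, ab.2)
  else (ab.1, (2 * ab.1 + ab.2) / 3).
pose I := fix I k := if k is k'.+1 then step (I k') (e k') else (0, 1).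
have IS k : I k.+1 = step (I k) (e k) by [].
have lt k : (I k).1 < (I k).2.
  elim: k => [|k]; first by rewrite /= ltr01.
  by rewrite IS /step => h; case: ifP => _ /=; lra.
have mono1 k : (I k).1 <= (I k.+1).1 /\ (I k.+1).2 <= (I k).2.
  by have := lt k; rewrite IS /step => h; case: ifP => _ /=; split; lra.
have mono k l : (k <= l)%N -> (I k).1 <= (I l).1 /\ (I l).2 <= (I k).2.
  elim: l => [|l IH]; first by rewrite leqn0 => /eqP ->.
  rewrite leq_eqVlt => /orP[/eqP -> //|/IH[h1 h2]].
  by have [h3 h4] := mono1 l; split; [exact: le_trans h3 | exact: le_trans h2].
have cross k l : (I k).1 <= (I l).2.
  have [h1 _] := mono _ _ (leq_maxl k l); have [_ h2] := mono _ _ (leq_maxr k l).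
  by apply: le_trans h2; apply: le_trans h1 _; apply: ltW.
pose A : set R := [set (I k).1 | k in [set: nat]].
have hA : has_sup A.
  split; first by exists (I 0%N).1, 0%N.
  by exists (I 0%N).2 => _ [k _ <-].
have supl k : (I k).1 <= sup A by apply: ub_le_sup; [case: hA | exists k].
have supr k : sup A <= (I k).2 by apply: ge_sup; [case: hA | move=> _ [l _ <-]].
have := supl (f (sup A)).+1; have := supr (f (sup A)).+1.
rewrite !IS /step ef.
have := lt (f (sup A)); have := supl (f (sup A)); have := supr (f (sup A)).
case: ifP => [|/negbT]; rewrite -?ltNge /=; lra.
Qed.

Lemma complex_uncountable (R : realType) : ~ countable [set: R[i]].
Proof.
move=> /countable_injP[f finj]; apply: (@real_uncountable R); apply/countable_injP.
exists (fun x => f x%:C%C) => x y _ _ /finj.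
by rewrite !mem_set => // /(_ isT isT)[].
Qed.

(** * Forms of integer degree *)

Section Homogeneous.
Variables (K : comNzRingType) (n : nat).
Local Notation P := {mpoly K[n]}.

Lemma euler (p : P) k : p \is k.-homog -> \sum_i 'X_i * p^`M(i) = p *+ k.
Proof.
move=> hp; rewrite {1 2}[p]mpolyE -sumrMnl.
under eq_bigr do rewrite raddf_sum mulr_sumr /=.
rewrite exchange_big /= big_seq [RHS]big_seq; apply: eq_bigr => m mp.
have <- : mdeg m = k by exact: (dhomog_mf hp mp).
rewrite mdegE /= -sumrMnr; apply: eq_bigr => i _.
rewrite mderivZ mderivX scaler_nat -scalerAr mulrnAr -mpolyXD scalerMnr.
case: (posnP (m i)) => [->|mi]; first by rewrite !mulr0n.
by rewrite addmC submK // lep1mP -lt0n.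
Qed.

Lemma meval_scale (p : P) k (a : K) (v : 'I_n -> K) : p \is k.-homog ->
  p.@[fun i => a * v i] = a ^+ k * p.@[v].
Proof.
move=> hp; rewrite !mevalE mulr_sumr big_seq [RHS]big_seq.
apply: eq_bigr => m mp; rewrite mulrCA; congr (_ * _).
under eq_bigr do rewrite exprMn.
have <- : mdeg m = k by exact: (dhomog_mf hp mp).
by rewrite big_split /= prodrXr mdegE.
Qed.

(** Degrees are integers, with no nonzero form in negative degree: the counts below
then hold without distinguishing cases. *)
Definition forms (k : int) : set P :=
  [set p | if k is Posz j then p \is j.-homog else p = 0].

Definition form_part (k : int) (p : P) : P :=
  if k is Posz j then pihomog mdeg j p else 0.

Lemma form_partP k p : forms k (form_part k p).
Proof. by case: k => k //=; exact: pihomogP. Qed.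

Lemma form_part_id k p : forms k p -> form_part k p = p.
Proof. by case: k => k //=; exact: pihomog_dE. Qed.

Lemma form_partD k p q : form_part k (p + q) = form_part k p + form_part k q.
Proof. by case: k => k /=; rewrite ?raddfD ?addr0. Qed.

Lemma form_partZ k a p : form_part k (a *: p) = a *: form_part k p.
Proof. by case: k => k /=; rewrite ?linearZ ?scaler0. Qed.

Lemma form_part0 k : form_part k 0 = 0.
Proof. by case: k => k //=; rewrite raddf0. Qed.

Lemma form_partB k p q : form_part k (p - q) = form_part k p - form_part k q.
Proof. by rewrite form_partD -scaleN1r form_partZ scaleN1r. Qed.

Lemma form_part_sum k (I : Type) (r : seq I) (Q : pred I) (F : I -> P) :
  form_part k (\sum_(i <- r | Q i) F i) = \sum_(i <- r | Q i) form_part k (F i).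
Proof. by apply: big_morph; [exact: form_partD | exact: form_part0]. Qed.

Lemma form_part_homog k j p : p \is j.-homog -> form_part k p = if k == j then p else 0.
Proof.
move=> hp; case: eqVneq => [->|]; first exact: form_part_id.
case: k => k //= kj; apply: pihomog_ne0 hp => //.
by apply: contra kj => /eqP ->.
Qed.

Lemma form_partM k m g p : g \is m.-homog -> form_part (k + m%:Z) (g * p) = g * form_part k p.
Proof.
move=> hg; rewrite (pihomog_partitionE (leqnn (mmeasure mdeg p))).
rewrite mulr_sumr !form_part_sum mulr_sumr; apply: eq_bigr => j _.
have hj := pihomogP mdeg j p; rewrite (form_part_homog k hj).
rewrite (form_part_homog _ (dhomogM hg hj)) PoszD addrC (inj_eq (addrI _)).
by case: eqP; rewrite ?mulr0.
Qed.

Lemma forms0 k : forms k 0.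
Proof. by case: k => k //=; exact: dhomog0. Qed.

Lemma formsD k p q : forms k p -> forms k q -> forms k (p + q).
Proof. by case: k => k /=; [exact: dhomogD | move=> -> ->; rewrite addr0]. Qed.

Lemma formsZ k a p : forms k p -> forms k (a *: p).
Proof. by case: k => k /=; [exact: dhomogZ | move=> ->; rewrite scaler0]. Qed.

Lemma formsN k p : forms k p -> forms k (- p).
Proof. by rewrite -scaleN1r; exact: formsZ. Qed.

Lemma formsB k p q : forms k p -> forms k q -> forms k (p - q).
Proof. by move=> hp /formsN; exact: formsD. Qed.

Lemma formsM k m g p : g \is m.-homog -> forms k p -> forms (k + m%:Z) (g * p).
Proof. by move=> hg /form_part_id <-; rewrite -(form_partM _ _ hg); exact: form_partP. Qed.

Lemma formsM_int k l p q : forms k p -> forms l q -> forms (k + l) (p * q).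
Proof.
by case: k => k /= hp hq; [rewrite addrC; exact: formsM | rewrite hp mul0r; exact: forms0].
Qed.

Lemma forms_sum k (I : Type) (r : seq I) (Q : pred I) (F : I -> P) :
  (forall i, Q i -> forms k (F i)) -> forms k (\sum_(i <- r | Q i) F i).
Proof. by move=> h; elim/big_ind: _ => //; [exact: forms0 | exact: formsD]. Qed.

Lemma homogX i : ('X_i : P) \is 1.-homog.
Proof. by rewrite dhomogX /= mdeg1. Qed.

Lemma forms_mderiv k i p : forms k p -> forms (k - 1) p^`M(i).
Proof.
case: k => [[|k]|k] /= hp; last by rewrite hp mderiv0.
  suff -> : p^`M(i) = 0 by [].
  apply/mpolyP => m; rewrite mcoeff_mderiv mcoeff0.
  rewrite (dhomog_nemf_coeff hp) ?mul0rn //= mdegD mdeg1.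
  by rewrite addn1.
rewrite subn1 /=.
apply/dhomogP => m.
rewrite mcoeff_msupp mcoeff_mderiv => h.
have : (m + U_(i))%MM \in msupp p.
  by rewrite mcoeff_msupp; apply: contraNneq h => ->; rewrite mul0rn.
by move/(dhomog_mf hp) => /=; rewrite mdegD mdeg1 addn1 => -[].
Qed.

Lemma mderivXn i (u : P) k : (u ^+ k.+1)^`M(i) = (u ^+ k * u^`M(i)) *+ k.+1.
Proof.
elim: k => [|k IH]; first by rewrite expr1 expr0 mul1r.
by rewrite exprS mderivM IH mulrnAr mulrA -exprS [RHS]mulrS [X in X + _]mulrC.
Qed.

End Homogeneous.

Section PowersInIdeal.
Variables (K : idomainType) (n : nat).
Local Notation P := {mpoly K[n.+1]}.

(** For homogeneous [g] of positive degree over an algebraically closed field such an [e]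
exists exactly when the origin is the only common zero of the [g i]. *)
Definition powers_in (g : 'I_n.+1 -> P) (e : nat) : Prop :=
  exists c : 'I_n.+1 -> 'I_n.+1 -> P, forall l, 'X_l ^+ e = \sum_i c l i * g i.

Lemma powers_in_pow e : powers_in (fun i => 'X_i ^+ e) e.
Proof.
exists (fun l i => (l == i)%:R) => l.
rewrite (bigD1 l) //= eqxx mul1r big1 ?addr0 // => i.
by rewrite eq_sym => /negbTE ->; rewrite mul0r.
Qed.

Lemma powers_in_X : powers_in (fun i => 'X_i) 1.
Proof. by have := powers_in_pow 1. Qed.

Variables (g : 'I_n.+1 -> P) (e : nat).
Hypothesis hg : powers_in g e.

Lemma okoszul_homotopies k : (k < n.+1)%N ->
  exists h, homotopy size (okoszul g) (xpow K n e k) h.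
Proof.
case: hg => c hc _; exists (ocontract (c (inord k))).
by rewrite /xpow hc; exact: ocontract_homotopy.
Qed.

Lemma skoszul_homotopies k : (k < n.+1)%N ->
  exists h, homotopy (fun S : {set 'I_n.+1} => #|S|) (skoszul g) (xpow K n e k) h.
Proof.
case: hg => c hc _; exists (scontract (c (inord k))).
by rewrite /xpow hc; exact: scontract_homotopy.
Qed.

Lemma okoszul_exact r u : (r < n.+1)%N ->
  (forall s, size s = r.+1 -> okoszul g u s = 0) ->
  exists w, forall s, size s = r -> u s = okoszul g w s.
Proof.
exact: (koszul_exact0 (okoszul_differential g) (@xpow_chain K n e)
  (@xpow_ideal0 K n e) okoszul_homotopies).
Qed.

Lemma okoszul_exact_mod f r u : f != 0 -> (r.+1 < n.+1)%N ->
  ideal_valued size (multiples f) r.+1 (okoszul g u) ->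
  exists w, ideal_valued size (multiples f) r (fun s => u s - okoszul g w s).
Proof.
exact: (koszul_exact_mod (okoszul_differential g) (@xpow_chain K n e)
  (@xpow_ideal0 K n e) okoszul_homotopies).
Qed.

Lemma skoszul_exact r u : (r < n.+1)%N ->
  (forall S : {set 'I_n.+1}, #|S| = r.+1 -> skoszul g u S = 0) ->
  exists w, forall S : {set 'I_n.+1}, #|S| = r -> u S = skoszul g w S.
Proof.
exact: (koszul_exact0 (skoszul_differential g) (@xpow_chain K n e)
  (@xpow_ideal0 K n e) skoszul_homotopies).
Qed.

(** Exactness in rank 0 of the Koszul complex modulo [f]. *)
Lemma torsion_free f u : f != 0 -> (1 < n.+1)%N ->
  (forall i, multiples f (g i * u)) -> multiples f u.
Proof.
move=> f0 n1 h; have [|w hw] := @okoszul_exact_mod f 0 (fun _ => u) f0 n1.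
  by move=> [|i []] //= _; rewrite subr0.
by have := hw [::] erefl; rewrite /= subr0.
Qed.

End PowersInIdeal.

(** * Translation along a line *)

Section Translation.
Variables (K : idomainType) (n : nat) (w : 'I_n -> K).
Local Notation P := {mpoly K[n]}.

Definition line (i : 'I_n) : {poly P} := ('X_i)%:P + (w i)%:MP *: 'X.

Fact translate_key : unit. Proof. by []. Qed.
(** The translate [p (x + T w)], as a polynomial in [T]. *)
Definition translate : P -> {poly P} :=
  locked_with translate_key (mmap (polyC \o @mpolyC n K) line).

Lemma translateC c : translate c%:MP = (c%:MP)%:P.
Proof. by rewrite /translate unlock mmapC. Qed.

Lemma translate_var i : translate 'X_i = line i.
Proof. by rewrite /translate unlock mmapX mmap1U. Qed.

Lemma translateD p q : translate (p + q) = translate p + translate q.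
Proof. by rewrite /translate unlock; exact: rmorphD. Qed.

Lemma translateM p q : translate (p * q) = translate p * translate q.
Proof. by rewrite /translate unlock; exact: rmorphM. Qed.

Lemma translateXn p k : translate (p ^+ k) = translate p ^+ k.
Proof.
elim: k => [|k IH]; last by rewrite !exprS translateM IH.
by rewrite !expr0 -mpolyC1 translateC mpolyC1.
Qed.

Lemma translate_at0 p : (translate p).[0] = p.
Proof.
elim/mpoly_ring_ind: p => [c|i|p q hp hq|p q hp hq].
- by rewrite translateC hornerC.
- by rewrite translate_var /line !hornerE.
- by rewrite translateD hornerD hp hq.
- by rewrite translateM hornerM hp hq.
Qed.

(** Here [a] is only a bound for the degree of [q], since [c] may vanish. *)
Definition top_coef (q : {poly P}) (a : nat) (c : K) : Prop :=
  (size q <= a.+1)%N /\ q`_a = c%:MP.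

Lemma top_coefM q q' a a' c c' :
  top_coef q a c -> top_coef q' a' c' -> top_coef (q * q') (a + a') (c * c').
Proof.
move=> [sq qa] [sq' qa']; split.
  apply: leq_trans (size_polyMleq _ _) _; rewrite -subn1 leq_subLR.
  by rewrite add1n -addnS -addSn; apply: leq_add.
rewrite coefM.
have ha : (a < (a + a').+1)%N by rewrite ltnS leq_addr.
rewrite (bigD1 (Ordinal ha)) //= addKn qa qa' mpolyCM big1 ?addr0 // => i.
rewrite -val_eqE neq_ltn /= => /orP[] hi.
  rewrite [q'`_ _]nth_default ?mulr0 //; apply: leq_trans sq' _.
  by move: (nat_of_ord i) hi => j hi; lia.
by rewrite nth_default ?mul0r //; apply: leq_trans sq hi.
Qed.

Lemma top_coef_monomial m : top_coef (translate 'X_[m]) (mdeg m) ('X_[m] : P).@[w].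
Proof.
have hX i : top_coef (translate 'X_i) 1 (w i).
  rewrite translate_var /line; split.
    apply: leq_trans (size_polyD _ _) _; rewrite geq_max.
    rewrite (leq_trans (size_polyC_leq1 _)) //=.
    by apply: leq_trans (size_scale_leq _ _) _; rewrite size_polyX.
  by rewrite coefD coefC coefZ coefX /= add0r mulr1.
have h1 : top_coef 1 0 1 by rewrite /top_coef size_poly1 coef1.
have hXk i k : top_coef (translate 'X_i ^+ k) k (w i ^+ k).
  elim: k => [|k IH]; first by rewrite !expr0.
  by rewrite !exprS -add1n; exact: top_coefM.
rewrite mpolyXE_id mdegE.
rewrite [meval _ _]rmorph_prod (big_morph translate translateM (_ : translate 1 = 1)); last first.
  by rewrite -mpolyC1 translateC mpolyC1.
elim/big_rec3: _ => [|i a p q _ IH]; first exact: h1.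
by rewrite translateXn rmorphXn /= mevalXU; exact: top_coefM.
Qed.

Lemma top_coef_homog p d : p \is d.-homog -> top_coef (translate p) d p.@[w].
Proof.
move=> hp; rewrite [p]mpolyE.
rewrite (big_morph translate translateD (_ : translate 0 = 0)); last first.
  by rewrite -mpolyC0 translateC mpolyC0.
rewrite [meval _ _]raddf_sum /= big_seq [X in top_coef _ _ X]big_seq.
have h0 : top_coef 0 d 0 by rewrite /top_coef size_poly0 coef0.
elim/big_rec2: _ => [|m q a mp [sq qa]]; first exact: h0.
have dm : mdeg m = d by exact: (dhomog_mf hp mp).
have [sm ma] := top_coef_monomial m; rewrite dm in sm ma.
rewrite -mul_mpolyC translateM translateC mevalM mevalC mul_polyC; split.
  apply: leq_trans (size_polyD _ _) _; rewrite geq_max sq andbT.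
  exact: leq_trans (size_scale_leq _ _) sm.
by rewrite coefD coefZ ma qa mpolyCD mpolyCM.
Qed.

End Translation.

(** * The ideal of a smooth hypersurface *)

(** All terms of the binomial expansion are multiples of [b ^+ m]. *)
Lemma power_divisible_sub (A : idomainType) (a b c : A) m :
  (forall k, exists q, a ^+ k.+1 = b ^+ k * q) ->
  multiples (b ^+ m) ((a - c * b) ^+ m.+1).
Proof.
move=> ha; rewrite exprDn; apply: ideal_sum; first exact: multiples_ideal.
move=> i _; rewrite -mulr_natr; apply: (ideal_mulr (multiples_ideal _)).
have : (i <= m.+1)%N by rewrite -ltnS.
rewrite leq_eqVlt => /orP[/eqP ->|im].
  exists ((- c) ^+ m.+1 * b); rewrite subnn expr0 mul1r -mulNr exprMn [b ^+ m.+1]exprS.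
  by rewrite [b * _]mulrC mulrCA.
rewrite subSn //; have [q ->] := ha (m - i)%N; exists (q * (- c) ^+ i).
rewrite -mulNr exprMn -(_ : b ^+ (m - i) * b ^+ i = b ^+ m); last by rewrite -exprD subnK.
by move: (b ^+ _) (b ^+ _) ((- c) ^+ _) => x y z; ring.
Qed.

Section Smooth.
Variables (K : numClosedFieldType) (n : nat) (f : {mpoly K[n.+1]}) (d : nat).
Local Notation P := {mpoly K[n.+1]}.
Hypothesis uncK : ~ countable [set: K].
Hypotheses (f0 : f != 0) (hf : f \is d.-homog) (d0 : (0 < d)%N) (n0 : (0 < n)%N).
Hypothesis smooth : forall v, v != 0 -> f.@[v] = 0 -> exists i, f^`M(i).@[v] != 0.

Lemma euler_f : \sum_i 'X_i * f^`M(i) = f *+ d.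
Proof. exact: euler. Qed.

(** By Euler's formula a common zero of the partial derivatives is a zero of [f], so it
is the origin by smoothness; the Nullstellensatz does the rest. *)
Lemma powers_in_gradient : exists e, powers_in (fun i => f^`M(i)) e.
Proof.
pose I : set P := [set a | exists c : 'I_n.+1 -> P, a = \sum_i c i * f^`M(i)].
have hI : is_ideal I.
  split=> [|_ _ [a ->] [b ->]|a _ [b ->]].
  - by exists (fun=> 0); rewrite big1 // => i _; rewrite mul0r.
  - by exists (fun i => a i + b i); rewrite -big_split; apply: eq_bigr => i _; rewrite mulrDl.
  - by exists (fun i => a * b i); rewrite mulr_sumr; apply: eq_bigr => i _; rewrite mulrA.
have /choice[k hk] l : exists k, I ('X_l ^+ k).
  apply: nullstellensatz => // v hv; rewrite mevalXU.
  have hvi i : f^`M(i).@[v] = 0.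
    apply: hv; exists (fun j => (j == i)%:R).
    by rewrite (bigD1 i) //= eqxx mul1r big1 ?addr0 // => j /negbTE ->; rewrite mul0r.
  have fv : f.@[v] = 0.
    have := congr1 (meval v) euler_f; rewrite raddf_sum mevalMn => /esym/eqP.
    rewrite big1 => [|i _]; last by rewrite /= mevalM hvi mulr0.
    by rewrite mulrn_eq0 eqn0Ngt d0 => /eqP.
  have [->//|v0] := eqVneq v 0.
  by have [j] := smooth v0 fv; rewrite hvi eqxx.
exists (\max_l k l)%N; suff /choice[c hc] : forall l, I ('X_l ^+ \max_l k l) by exists c.
move=> l; rewrite -(subnK (leq_bigmax l)) exprD; exact: idealM.
Qed.

Lemma gradient_torsion_free u : (forall i, multiples f (f^`M(i) * u)) -> multiples f u.
Proof. by have [e he] := powers_in_gradient; exact: (torsion_free he f0). Qed.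

Lemma X_torsion_free u : (forall i, multiples f ('X_i * u)) -> multiples f u.
Proof. exact: (torsion_free (powers_in_X K n) f0). Qed.

(** Inductively [u ^+ k.+1 = f ^+ k * q] and [u ^+ k.+2 = f ^+ k.+1 * q'], so
[u * q = f * q'].  Differentiating the second equality shows that [f] divides
[f^`M(i) * q' * u] for all [i], hence divides [q' * u]. *)
Lemma square_divisible_powers u : multiples f (u ^+ 2) ->
  forall k, exists q, u ^+ k.+1 = f ^+ k * q.
Proof.
move=> hu.
suff H k : exists q q', u ^+ k.+1 = f ^+ k * q /\ u ^+ k.+2 = f ^+ k.+1 * q'.
  by move=> k; have [q [_ [h _]]] := H k; exists q.
elim: k => [|k [q [q' [hq hq']]]].
  by have [q hq] := hu; exists u, q; rewrite mul1r expr1.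
suff [r hr] : multiples f (q' * u).
  by exists q', r; split=> //; rewrite exprSr hq' -mulrA hr [f ^+ k.+2]exprSr mulrA.
apply: gradient_torsion_free => i.
have fk0 m : f ^+ m != 0 by rewrite expf_neq0.
have uq : u * q = f * q'.
  apply: (mulfI (fk0 k)).
  by rewrite mulrCA -hq -exprS hq' exprS mulrA [f ^+ k * f]mulrC.
have D : q * u^`M(i) *+ k.+2 = f^`M(i) * q' *+ k.+1 + f * q'^`M(i).
  apply: (mulfI (fk0 k)).
  have := congr1 (mderiv i) hq'; rewrite [RHS]mderivM !mderivXn hq => E.
  rewrite mulrnAr mulrA E mulrDr exprS !mulrnAr mulrnAl; congr (_ *+ _ + _);
    move: (f^`M(i)) (q'^`M(i)) => x y; ring.
exists ((k.+1%:R)^-1 *: (q' * u^`M(i) *+ k.+2 - u * q'^`M(i))).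
(* Characteristic 0 is used to divide by [k.+1]. *)
have k0 : (k.+1%:R : K) != 0 by rewrite pnatr_eq0.
apply: (scalerI k0); rewrite -scalerAr scalerA divff // scale1r scaler_nat.
have -> : f * (q' * u^`M(i) *+ k.+2 - u * q'^`M(i)) =
  (f * q') * u^`M(i) *+ k.+2 - u * (f * q'^`M(i)).
  by rewrite mulrBr mulrnAr mulrA [f * (u * _)]mulrCA.
rewrite -uq.
have -> : u * q * u^`M(i) *+ k.+2 = u * (q * u^`M(i) *+ k.+2) by rewrite mulrnAr mulrA.
by rewrite D mulrDr addrK mulrnAr; congr (_ *+ _); rewrite mulrA mulrC.
Qed.

Lemma nonvanishing_point : exists w, f.@[w] != 0.
Proof.
apply: contrapT => h; have [|k] := nullstellensatz uncK (is_ideal0 P) (h := f).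
  by move=> v _; apply/eqP/negPn/negP => fv; apply: h; exists v.
by move=> /= /eqP; rewrite expf_eq0 (negbTE f0) andbF.
Qed.

(** In a direction [w] with [f.@[w] != 0] the translate [F] of [f] has degree [d] and an
invertible leading coefficient.  The remainder [S] of the translate of [u] by [F]
is such that [F ^+ d] divides [S ^+ d.+1], while [S] has degree at most [d - 1] and
[d.+1 * (d - 1) < d * d]; so [S = 0]. *)
Lemma square_radical u : multiples f (u ^+ 2) -> multiples f u.
Proof.
move=> /square_divisible_powers hu; have [w fw] := nonvanishing_point.
pose F := translate w f; pose U := translate w u.
have [sF Fd] := top_coef_homog w hf.
have Fd0 : F`_d != 0 by rewrite Fd mpolyC_eq0.
have sizeF : size F = d.+1.
  apply/eqP; rewrite eqn_leq sF ltnNge; apply/negP => /leq_sizeP/(_ d (leqnn d)).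
  by move/eqP; rewrite (negbTE Fd0).
have lF : lead_coef F \is a GRing.unit.
  rewrite lead_coefE sizeF /= Fd; apply/unitrP; exists (f.@[w]^-1)%:MP.
  by rewrite -!mpolyCM divff // mulVf.
pose Q := Pdiv.Idomain.divp U F; pose S := Pdiv.Idomain.modp U F.
have US : U = Q * F + S := Pdiv.IdomainUnit.divp_eq lF U.
have F0 : F != 0 by rewrite -size_poly_gt0 sizeF.
suff S0 : S = 0.
  exists Q.[0]; have := congr1 (horner^~ 0) US.
  have -> : U.[0] = u by exact: translate_at0.
  by rewrite S0 addr0 hornerM (translate_at0 w f : F.[0] = f) mulrC.
apply/eqP/negPn/negP => S0.
have sS : (size S < size F)%N by rewrite Pdiv.CommonIdomain.ltn_modp.
have [G hG] : multiples (F ^+ d) (S ^+ d.+1).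
  have -> : S = U - Q * F by rewrite US addrC addKr.
  apply: power_divisible_sub => k; have [q hq] := hu k; exists (translate w q).
  by rewrite /U /F -!translateXn hq translateM.
have G0 : G != 0 by apply: contraNneq S0 => G0; move/eqP: hG; rewrite G0 mulr0 expf_eq0.
have /(congr1 (fun p : {poly P} => size p)) := hG; rewrite size_mul ?expf_neq0 //.
have := size_exp F d; have := size_exp S d.+1.
move: S0 G0; rewrite -!size_poly_gt0 sizeF /=; move: sS; rewrite sizeF ltnS.
move: (size S) (size G) (size (S ^+ _)) (size (F ^+ _)) => [|a] b x y //= ad _ b0 hx hy hxy.
have : (a * d.+1 <= d.-1 * d.+1)%N by rewrite leq_mul2r -ltnS prednK // ad orbT.
rewrite -hx; case: (d) d0 hy => // e _ /=; lia.
Qed.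

Lemma power_radical u k : multiples f (u ^+ k) -> multiples f u.
Proof.
elim/ltn_ind: k => -[|[|k]] IH hk.
- by case: hk => q; rewrite expr0 => hq; exists (q * u); rewrite mulrA -hq mul1r.
- by rewrite expr1 in hk.
- apply: (IH (uphalf k.+2)); first rewrite /= !ltnS uphalf_half.
    by move: (odd k) (odd_double_half k); lia.
  apply: square_radical; rewrite -exprM.
  have -> : (uphalf k.+2 * 2 = k.+2 + odd k)%N by rewrite muln2 -{2}(odd_double_half k) /=; lia.
  by rewrite exprD; apply: (ideal_mulr (multiples_ideal _)).
Qed.

(** Multiplying by ['X_i] makes the polynomial vanish at the origin too. *)
Lemma vanishing_multiple p : (forall v, v != 0 -> f.@[v] = 0 -> p.@[v] = 0) ->
  multiples f p.
Proof.
move=> hp; apply: X_torsion_free => i.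
have [|k] := nullstellensatz uncK (multiples_ideal f) (h := 'X_i * p).
  move=> v hv; rewrite mevalM mevalXU.
  have [->|v0] := eqVneq v 0; first by rewrite mul0r.
  by rewrite hp ?mulr0 //; apply: hv; exists 1; rewrite mulr1.
exact: power_radical.
Qed.

End Smooth.

(** * Global functions and Koszul cocycles on the cone *)

Lemma poly_zero_units (K : numDomainType) (q : {poly K}) :
  (forall a, a != 0 -> q.[a] = 0) -> q = 0.
Proof.
move=> h; apply/eqP/negPn/negP => q0.
pose rs : seq K := [seq i.+1%:R | i <- iota 0 (size q)].
have : (size rs < size q)%N.
  apply: max_poly_roots => //.
    by apply/allP => _ /mapP[i _ ->]; rewrite rootE h // pnatr_eq0.
  rewrite map_inj_uniq ?iota_uniq // => i j /eqP; rewrite eqr_nat eqSS => /eqP //.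
by rewrite size_map size_iota ltnn.
Qed.

Lemma meval_scale_poly (K : comNzRingType) n (p : {mpoly K[n]}) (u : 'I_n -> K) :
  exists2 q : {poly K}, (forall a, q.[a] = p.@[fun i => a * u i]) &
    forall j, q`_j = (pihomog mdeg j p).@[u].
Proof.
exists (\poly_(j < msize p) (pihomog mdeg j p).@[u]) => [a|j].
  rewrite horner_poly [in RHS](pihomog_partitionE (leqnn (mmeasure mdeg p))) raddf_sum /=.
  apply: eq_bigr => j _; rewrite (meval_scale _ _ (pihomogP _ _ _)) mulrC //.
rewrite coef_poly; case: ltnP => // hj; apply/esym.
rewrite pihomogE big_seq_cond big1 ?meval0 // => m /andP[/msize_mdeg_lt mp /eqP mj].
by move: mp; rewrite [mdeg m]mj ltnNge hj.
Qed.

Section Sections.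
Variables (K : numClosedFieldType) (n : nat) (f : {mpoly K[n.+1]}) (d : nat).
Local Notation P := {mpoly K[n.+1]}.
Hypothesis uncK : ~ countable [set: K].
Hypotheses (f0 : f != 0) (hf : f \is d.-homog) (d0 : (0 < d)%N) (n2 : (2 < n)%N).
Hypothesis smooth : forall v, v != 0 -> f.@[v] = 0 -> exists i, f^`M(i).@[v] != 0.

Definition on_cone (Q : ('I_n.+1 -> K) -> Prop) : Prop :=
  forall v, v != 0 -> f.@[v] = 0 -> Q v.

Lemma on_cone_multiple p : on_cone (fun v => p.@[v] = 0) <-> multiples f p.
Proof.
split=> [hp|[q ->] v _ fv]; last by rewrite mevalM fv mul0r.
apply: (vanishing_multiple uncK f0 hf d0 _ smooth) => //.
exact: leq_trans n2.
Qed.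

Lemma nonzero_coordinate (v : 'I_n.+1 -> K) : v != 0 -> exists i, v i != 0.
Proof.
move=> v0; apply: contrapT => h; move/eqP: v0; apply; apply/funext => i.
by apply/eqP/negPn/negP => vi; apply: h; exists i.
Qed.

(** The polynomials [h] such that [h s] is a polynomial function form an ideal whose only
zero on the cone is the origin, so it contains the [x_l ^ e] for some [e].  The
numerators [p l = x_l ^ e * s] form a Koszul cocycle of the [x_l ^ e] modulo [f]; it
is a coboundary, that is, [p l = x_l ^ e * w] for a single polynomial [w]. *)
Lemma global_function (s : ('I_n.+1 -> K) -> K) :
  on_cone (fun v => exists h r : P, h.@[v] != 0 /\
    on_cone (fun u => h.@[u] * s u = r.@[u])) ->
  exists p : P, on_cone (fun u => s u = p.@[u]).
Proof.
move=> hs; pose J : set P := [set h | exists r : P, on_cone (fun u => h.@[u] * s u = r.@[u])].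
have hJ : is_ideal J.
  split=> [|a b [r hr] [q hq]|a b [r hr]].
  - by exists 0 => u _ _; rewrite !meval0 mul0r.
  - by exists (r + q) => u u0 fu; rewrite !mevalD mulrDl hr ?hq.
  - by exists (a * r) => u u0 fu; rewrite !mevalM -mulrA hr.
have /choice[k hk] l : exists k, J ('X_l ^+ k).
  apply: nullstellensatz => // v hv; rewrite mevalXU.
  have [->//|v0] := eqVneq v 0.
  have fv : f.@[v] = 0.
    by apply: hv; exists 0 => u _ fu; rewrite fu mul0r meval0.
  by have [h [r [hv0 hr]]] := hs v v0 fv; move: hv0; rewrite hv ?eqxx //; exists r.
pose e := (\max_l k l)%N.
have /choice[p hp] l : J ('X_l ^+ e).
  by rewrite -(subnK (leq_bigmax l : (k l <= e)%N)) exprD; exact: idealM.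
have n1 : (2 < n.+1)%N by rewrite ltnS ltnW.
have [|w hw] := okoszul_exact_mod (powers_in_pow K n e) (r := 1)
    (u := fun s => if s is l :: _ then p l else 0) f0 n1.
  move=> [|l [|m []]] //= _; rewrite !subr0; apply/on_cone_multiple => u u0 fu.
  rewrite mevalB !mevalM -(hp l u u0 fu) -(hp m u u0 fu); ring.
exists (w [::]) => u u0 fu; have [l ul] := nonzero_coordinate u0.
have := (on_cone_multiple _).2 (hw [:: l] erefl) u u0 fu.
rewrite /= subr0 mevalB -hp // mevalM -mulrBr => /eqP.
by rewrite mulf_eq0 rmorphXn /= mevalXU expf_eq0 (negbTE ul) andbF /= subr_eq0 => /eqP.
Qed.

(** Compare the coefficients of [a] in [p (a u) = a ^ k * s u]. *)
Lemma homogeneous_function (s : ('I_n.+1 -> K) -> K) (k : int) (p : P) :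
  on_cone (fun u => forall a, a != 0 -> s (fun i => a * u i) = a ^ k * s u) ->
  on_cone (fun u => s u = p.@[u]) -> on_cone (fun u => s u = (form_part k p).@[u]).
Proof.
move=> hs hp u u0 fu.
have scale a : a != 0 -> p.@[fun i => a * u i] = a ^ k * s u.
  move=> a0; rewrite -hs // hp //; last by rewrite (meval_scale _ _ hf) fu mulr0.
  have [i ui] := nonzero_coordinate u0.
  by apply/eqP => /(congr1 (fun v => v i)) /eqP; rewrite mulf_eq0 (negbTE a0) (negbTE ui).
have [q qp qc] := meval_scale_poly p u.
case: k hs scale => k hs scale /=.
  have /(congr1 (fun r : {poly K} => r`_k)) : q - s u *: 'X^k = 0.
    apply: poly_zero_units => a a0.
    by rewrite !hornerE qp scale // mulrC subrr.
  by rewrite coefB coefZ coefXn eqxx mulr1 qc coef0 => /subr0_eq ->.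
have /(congr1 (fun r : {poly K} => r`_0)) : q * 'X^(k.+1) - (s u)%:P = 0.
  apply: poly_zero_units => a a0.
  rewrite !hornerE qp scale // NegzE -exprnN mulrC mulrA divff ?mul1r ?subrr //.
  by rewrite expf_neq0.
by rewrite coefB coefC coefMXn coef0 /= sub0r meval0 => /eqP; rewrite oppr_eq0 => /eqP.
Qed.

Lemma graded_multiple k p q : multiples f (p - q) -> forms k p ->
  exists2 r, forms (k - d%:Z) r & p = form_part k q + f * r.
Proof.
move=> [r hr] hp; exists (form_part (k - d%:Z) r); first exact: form_partP.
rewrite -(form_partM _ _ hf) subrK -hr form_partB (form_part_id hp); ring.
Qed.

(** A vector of forms proportional to [x] at all points of the hypersurface is a
multiple of [x] modulo [f]. *)
Lemma koszul_cocycle1 k (a : 'I_n.+1 -> P) : (forall i, forms (k + 1) (a i)) ->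
  (forall i j, multiples f ('X_i * a j - 'X_j * a i)) ->
  exists (c : P) (w : 'I_n.+1 -> P), [/\ forms k c, forall i, forms (k + 1 - d%:Z) (w i) &
    forall i, a i = c * 'X_i + f * w i].
Proof.
move=> ha hm; have n1 : (2 < n.+1)%N by rewrite ltnS ltnW.
have [|w hw] := okoszul_exact_mod (powers_in_X K n) (r := 1)
    (u := fun s => if s is l :: _ then a l else 0) f0 n1.
  by move=> [|l [|m []]] //= _; rewrite !subr0; exact: hm.
have /choice[r hr] i : exists r,
    forms (k + 1 - d%:Z) r /\ a i = 'X_i * form_part k (w [::]) + f * r.
  have := hw [:: i] erefl; rewrite /= subr0 => h.
  have [r hr E] := graded_multiple h (ha i).
  by exists r; split=> //; rewrite E -(form_partM _ _ (homogX _ i)).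
exists (form_part k (w [::])), r; split=> [|i|i]; [exact: form_partP | by have [] := hr i |].
by have [_ ->] := hr i; rewrite mulrC.
Qed.

(** This is where the vanishing of the first cohomology of all O_X(k) enters: it lifts
the bivector of a derivation to a vector of forms. *)
Lemma koszul_cocycle2 k (b : 'I_n.+1 -> 'I_n.+1 -> P) : (forall i j, forms (k + 1) (b i j)) ->
  (forall i j l, multiples f ('X_i * b j l - 'X_j * b i l + 'X_l * b i j)) ->
  exists2 a : 'I_n.+1 -> P, forall i, forms k (a i) &
    forall i j, multiples f (b i j - ('X_i * a j - 'X_j * a i)).
Proof.
move=> hb hm; have n1 : (3 < n.+1)%N by rewrite ltnS.
have [|w hw] := okoszul_exact_mod (powers_in_X K n) (r := 2)
    (u := fun s => if s is [:: i, j & _] then b i j else 0) f0 n1.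
  move=> [|i [|j [|l []]]] //= _; rewrite !subr0.
  by rewrite opprB addrA addrAC; exact: hm.
exists (fun i => form_part k (w [:: i])) => [i|i j]; first exact: form_partP.
have := hw [:: i; j] erefl; rewrite /= !subr0 => h.
have [r hr ->] := graded_multiple h (hb i j).
by exists r; rewrite form_partB -!(form_partM _ _ (homogX _ _)) addrAC subrr add0r.
Qed.

End Sections.

(** * Local fractions *)

Section LocalFractions.
Variables (R : realType) (f : {mpoly R[i][4]}).
Local Notation C := R[i].
Local Notation V := ('I_4 -> C).
Local Notation fct := (V -> C^o).
Local Notation P := {mpoly C[4]}.

Lemma zopen_pts_sub U : zopen f U -> U `<=` pts f.
Proof. by move=> [G _ ->] v []. Qed.

Definition basic_open (g : P) : set V := [set v | pts f v /\ g.@[v] != 0].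

Lemma zopen_basic g k : g \is k.-homog -> zopen f (basic_open g).
Proof.
move=> hg; exists [set g] => [_ ->|]; first by exists k.
by apply/seteqP; split=> [v [hv gv]|v [hv [_ -> gv]]]; split=> //; exists g.
Qed.

Lemma zopenI U W : zopen f U -> zopen f W -> zopen f (U `&` W).
Proof.
move=> [G hG ->] [H hH ->]; exists [set g | exists a b, [/\ G a, H b & g = a * b]].
  by move=> _ [a [b [/hG[k ka] /hH[l lb] ->]]]; exists (k + l)%N; exact: dhomogM.
apply/seteqP; split=> [v [[hv [a Ga av]] [_ [b Hb bv]]]|v [hv [_ [a [b [Ga Hb ->]]]]]].
  by split=> //; exists (a * b); [exists a, b | rewrite mevalM mulf_neq0].
by rewrite mevalM mulf_eq0 negb_or => /andP[av bv]; split; split=> //; [exists a | exists b].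
Qed.

Lemma zopen_basic_nbhd U v : zopen f U -> U v ->
  exists g k, [/\ g \is k.-homog, g.@[v] != 0 & basic_open g `<=` U].
Proof.
move=> [G hG ->] [hv [g Gg gv]]; have [k hk] := hG _ Gg; exists g, k; split=> //.
by move=> w [hw gw]; split=> //; exists g.
Qed.

Lemma pts_scale d v a : f \is d.-homog -> a != 0 -> pts f v -> pts f (fun i => a * v i).
Proof.
move=> hf a0 [v0 fv]; split; last by rewrite (meval_scale _ _ hf) fv mulr0.
have [i vi] := nonzero_coordinate v0.
by apply/eqP => /(congr1 (fun v => v i)) /eqP; rewrite mulf_eq0 (negbTE a0) (negbTE vi).
Qed.

Lemma zopen_scale d U v a : f \is d.-homog -> zopen f U -> a != 0 -> U v ->
  U (fun i => a * v i).
Proof.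
move=> hf [G hG ->] a0 [hv [g Gg gv]]; split; first exact: pts_scale hf _ _.
by exists g => //; have [k hk] := hG _ Gg; rewrite (meval_scale _ _ hk) mulf_neq0 ?expf_neq0.
Qed.

Definition fraction_on (e : int) (W : set V) (s : fct) : Prop :=
  exists (l : nat) (p q : P), [/\ forms (l%:Z + e) p, q \is l.-homog &
    forall w, W w -> q.@[w] != 0 /\ s w = p.@[w] / q.@[w]].

Definition fraction_near (e : int) (U : set V) (s : fct) (v : V) : Prop :=
  exists W, [/\ zopen f W, W v, W `<=` U & fraction_on e W s].

(** The degrees of numerators may be taken to be integers: multiplying numerator and
denominator by a power of a coordinate makes them nonnegative. *)
Lemma O_XP e U s : O_X f e U s <->
  (forall v, ~ U v -> s v = 0) /\ (forall v, U v -> fraction_near e U s v).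
Proof.
split=> -[s0 hs]; split=> // v Uv; have [W [oW Wv WU]] := hs v Uv.
  move=> [k [l [p [q [hp hq kl h]]]]]; exists W; split=> //.
  by exists l, p, q; split=> //; rewrite -kl.
move=> [l [p [q [hp hq h]]]]; have [v0 _] := zopen_pts_sub oW Wv.
have [i vi] := nonzero_coordinate v0.
exists (W `&` basic_open 'X_i); split.
- by apply: zopenI => //; exact: zopen_basic (homogX _ i).
- by split=> //; split; [exact: zopen_pts_sub oW _ Wv | rewrite mevalXU].
- by move=> w [/WU].
have hX k : ('X_i : P) ^+ k \is k.-homog by have := dhomogMn k (homogX C i); rewrite mul1n.
have hq' m : 'X_i ^+ m * q \is (m + l).-homog by exact: dhomogM.
have [k [m [hk hp']]] : exists k m : nat, k%:Z = (m + l)%:Z + e /\ ('X_i ^+ m * p) \is k.-homog.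
  case E : (l%:Z + e) hp => [k|k] /= hp.
    exists k, 0%N; rewrite add0n mul1r E; split=> //.
  exists 0%N, k.+1; rewrite hp mulr0 PoszD -addrA E NegzE subrr; split=> //.
  exact: dhomog0.
exists k, (m + l)%N, ('X_i ^+ m * p), ('X_i ^+ m * q).
split=> //; first exact: hq'; move=> w [/h[qw sw] [_]]; rewrite mevalXU => wi.
have wm : ('X_i ^+ m).@[w] != 0 by rewrite rmorphXn /= mevalXU expf_neq0.
rewrite !mevalM mulf_neq0 // sw; split=> //.
by rewrite -mulf_div divff // mul1r.
Qed.

Lemma fraction_on_sub e W W' s : W' `<=` W -> fraction_on e W s -> fraction_on e W' s.
Proof. by move=> sW [l [p [q [hp hq h]]]]; exists l, p, q; split=> // w /sW/h. Qed.

Lemma fraction_on_eq e W s t : (forall w, W w -> s w = t w) ->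
  fraction_on e W s -> fraction_on e W t.
Proof.
move=> st [l [p [q [hp hq h]]]]; exists l, p, q; split=> // w Ww.
by rewrite -st //; exact: h.
Qed.

Lemma fraction_onD e W s t : fraction_on e W s -> fraction_on e W t ->
  fraction_on e W (s + t).
Proof.
move=> [l [p [q [hp hq h]]]] [l' [p' [q' [hp' hq' h']]]].
exists (l + l')%N, (q' * p + q * p'), (q * q'); split=> [||w Ww].
- apply: formsD.
    by have := formsM hq' hp; rewrite PoszD; congr forms; ring.
  by have := formsM hq hp'; rewrite PoszD; congr forms; ring.
- exact: dhomogM.
have [qw sw] := h w Ww; have [qw' sw'] := h' w Ww.
rewrite mevalD !mevalM mulf_neq0 //; split=> //.
rewrite (_ : (s + t) w = s w + t w) // sw sw' addf_div //.
by rewrite [p.@[w] * _]mulrC [p'.@[w] * _]mulrC.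
Qed.

Lemma fraction_onM e e' W s t : fraction_on e W s -> fraction_on e' W t ->
  fraction_on (e + e') W (s \* t).
Proof.
move=> [l [p [q [hp hq h]]]] [l' [p' [q' [hp' hq' h']]]].
exists (l + l')%N, (p * p'), (q * q'); split=> [||w Ww].
- by have := formsM_int hp hp'; rewrite PoszD addrACA.
- exact: dhomogM.
have [qw sw] := h w Ww; have [qw' sw'] := h' w Ww.
by rewrite !mevalM mulf_neq0 //= sw sw' mulf_div.
Qed.

Lemma O_X_off e U s v : O_X f e U s -> ~ U v -> s v = 0.
Proof. by move=> /O_XP[h _]; exact: h. Qed.

Lemma O_X_near e U s v : O_X f e U s -> U v -> fraction_near e U s v.
Proof. by move=> /O_XP[_ h]; exact: h. Qed.

Lemma O_XD e U s t : O_X f e U s -> O_X f e U t -> O_X f e U (s + t).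
Proof.
move=> hs ht; apply/O_XP; split=> v Uv.
  by rewrite (_ : (s + t) v = s v + t v) // (O_X_off hs) // (O_X_off ht) // addr0.
have [W [oW Wv WU hW]] := O_X_near hs Uv; have [W' [oW' Wv' WU' hW']] := O_X_near ht Uv.
exists (W `&` W'); split=> //; [exact: zopenI | by move=> w [/WU] | ].
by apply: fraction_onD; [apply: fraction_on_sub hW | apply: fraction_on_sub hW'] => w [].
Qed.

Lemma O_XM e e' U s t : O_X f e U s -> O_X f e' U t -> O_X f (e + e') U (s \* t).
Proof.
move=> hs ht; apply/O_XP; split=> v Uv.
  by rewrite /= (O_X_off hs) // mul0r.
have [W [oW Wv WU hW]] := O_X_near hs Uv; have [W' [oW' Wv' WU' hW']] := O_X_near ht Uv.
exists (W `&` W'); split=> //; [exact: zopenI | by move=> w [/WU] | ].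
by apply: fraction_onM; [apply: fraction_on_sub hW | apply: fraction_on_sub hW'] => w [].
Qed.

Lemma restrE (W : set V) (s : fct) v : W v -> restr W s v = s v.
Proof. by move=> Wv; rewrite /restr patchT // mem_set. Qed.

Lemma restr_off (W : set V) (s : fct) v : ~ W v -> restr W s v = 0.
Proof. by move=> Wv; rewrite /restr patchC // mem_set. Qed.

Lemma O_X_restr e U W s : zopen f W -> W `<=` U -> O_X f e U s -> O_X f e W (restr W s).
Proof.
move=> oW WU hs; apply/O_XP; split=> v Wv; first exact: restr_off.
have [W' [oW' Wv' WU' hW']] := O_X_near hs (WU _ Wv).
exists (W `&` W'); split=> //; first exact: zopenI.
apply: (fraction_on_eq (s := s)); first by move=> w [Ww _]; rewrite restrE.
by apply: fraction_on_sub hW' => w [].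
Qed.

Lemma O_X_fraction e U l p q : zopen f U -> forms (l%:Z + e) p -> q \is l.-homog ->
  (forall w, U w -> q.@[w] != 0) ->
  O_X f e U (restr U (fun v => p.@[v] / q.@[v])).
Proof.
move=> oU hp hq h; apply/O_XP; split=> v Uv; first exact: restr_off.
exists U; split=> //; exists l, p, q; split=> // w Uw.
by rewrite restrE //; split=> //; exact: h.
Qed.

Lemma O_X_scale d e U s v a : f \is d.-homog -> zopen f U -> O_X f e U s -> a != 0 ->
  s (fun i => a * v i) = a ^ e * s v.
Proof.
move=> hf oU hs a0.
have ainv : (fun i => a^-1 * (a * v i)) = v by apply/funext => i; rewrite mulKf.
have [Uv|nUv] := pselect (U v); last first.
  rewrite !(O_X_off hs) ?mulr0 // => Uav; apply: nUv; rewrite -ainv.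
  by apply: zopen_scale hf _ _ Uav => //; rewrite invr_eq0.
have [W [oW Wv WU [l [p [q [hp hq h]]]]]] := O_X_near hs Uv.
have Wav := zopen_scale hf oW a0 Wv.
have [qv ->] := h _ Wv; have [qav ->] := h _ Wav.
rewrite (meval_scale _ _ hq).
case E : (l%:Z + e) hp => [k|k] /= hp; last by rewrite hp !meval0 !mul0r mulr0.
rewrite (meval_scale _ _ hp).
have -> : e = k%:Z - l%:Z by rewrite -E addrC addKr.
by rewrite expfzDr // -exprnN -exprnP invfM mulrACA.
Qed.

End LocalFractions.

(** * Directional derivatives of fractions *)

Section Directional.
Variables (K : fieldType) (n : nat).
Local Notation P := {mpoly K[n]}.
Implicit Types (a b v : 'I_n -> K) (p q : P).

Definition dderiv a p v : K := \sum_j a j * p^`M(j).@[v].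

(** The derivative of [p / q] at [v] in the direction [a]. *)
Definition dfrac a p q v : K := (dderiv a p v - p.@[v] / q.@[v] * dderiv a q v) / q.@[v].

Lemma dderivD a p q v : dderiv a (p + q) v = dderiv a p v + dderiv a q v.
Proof. by rewrite -big_split; apply: eq_bigr => j _; rewrite mderivD mevalD mulrDr. Qed.

Lemma dderivZ a c p v : dderiv a (c *: p) v = c * dderiv a p v.
Proof. by rewrite mulr_sumr; apply: eq_bigr => j _; rewrite mderivZ mevalZ mulrCA. Qed.

Lemma dderivB a p q v : dderiv a (p - q) v = dderiv a p v - dderiv a q v.
Proof. by rewrite dderivD -[- q]scaleN1r dderivZ mulN1r. Qed.

Lemma dderivM a p q v : dderiv a (p * q) v = p.@[v] * dderiv a q v + q.@[v] * dderiv a p v.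
Proof.
rewrite !mulr_sumr -big_split; apply: eq_bigr => j _.
rewrite /= mderivM mevalD !mevalM.
by move: (a j) (p.@[v]) (q.@[v]) (p^`M(j).@[v]) (q^`M(j).@[v]) => c x y z t; ring.
Qed.

Lemma dderivC a c v : dderiv a c%:MP v = 0.
Proof. by apply: big1 => j _; rewrite mderivC meval0 mulr0. Qed.

Lemma dderivX a i v : dderiv a 'X_i v = a i.
Proof.
rewrite /dderiv (bigD1 i) //= big1 ?addr0 => [|j ji].
  rewrite mderivX mnmE eqxx scale1r (_ : (U_(i) - U_(i))%MM = 0%MM) ?mpolyX0 ?meval1 ?mulr1 //.
  by apply/mnmP => k; rewrite mnmBE subnn mnm0E.
by rewrite mderivX mnmE eq_sym (negbTE ji) scale0r meval0 mulr0.
Qed.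

Lemma dderiv_lin a b t p v : dderiv (fun j => t * a j + b j) p v = t * dderiv a p v + dderiv b p v.
Proof. by rewrite mulr_sumr -big_split; apply: eq_bigr => j _; rewrite mulrDl mulrA. Qed.

Lemma dderiv_euler p k v : p \is k.-homog -> dderiv v p v = p.@[v] *+ k.
Proof.
move=> hp; rewrite -mevalMn -(euler hp) raddf_sum; apply: eq_bigr => j _.
by rewrite /= mevalM mevalXU.
Qed.

Lemma dfrac_lin a b t p q v :
  dfrac (fun j => t * a j + b j) p q v = t * dfrac a p q v + dfrac b p q v.
Proof.
rewrite /dfrac !dderiv_lin.
move: (dderiv a p v) (dderiv b p v) (dderiv a q v) (dderiv b q v) => x y z u.
by move: (p.@[v]) (q.@[v]^-1) => r s; ring. Qed.

Lemma dderiv_vscale a t p v : dderiv (fun j => t * a j) p v = t * dderiv a p v.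
Proof. by rewrite mulr_sumr; apply: eq_bigr => j _; rewrite mulrA. Qed.

Lemma dfrac_vscale a t p q v : dfrac (fun j => t * a j) p q v = t * dfrac a p q v.
Proof. by rewrite /dfrac !dderiv_vscale mulrCA -mulrBr mulrA. Qed.

(** A fraction of degree 0 is constant along the lines through the origin. *)
Lemma dfrac_euler p q k v : p \is k.-homog -> q \is k.-homog -> q.@[v] != 0 ->
  dfrac v p q v = 0.
Proof.
move=> hp hq qv; rewrite /dfrac (dderiv_euler _ hp) (dderiv_euler _ hq).
by rewrite mulrnAr divfK // subrr mul0r.
Qed.

Lemma dfracD a p q p' q' v : q.@[v] != 0 -> q'.@[v] != 0 ->
  dfrac a (q' * p + q * p') (q * q') v = dfrac a p q v + dfrac a p' q' v.
Proof.
rewrite /dfrac dderivD !dderivM mevalD !mevalM.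
move: (p.@[v]) (q.@[v]) (p'.@[v]) (q'.@[v]) (dderiv a p v) (dderiv a q v) (dderiv a p' v) (dderiv a q' v).
by move=> x y z t dx dy dz dt y0 t0; field; rewrite y0 t0.
Qed.

Lemma dfracM a p q p' q' v : q.@[v] != 0 -> q'.@[v] != 0 ->
  dfrac a (p * p') (q * q') v =
    p.@[v] / q.@[v] * dfrac a p' q' v + p'.@[v] / q'.@[v] * dfrac a p q v.
Proof.
rewrite /dfrac !dderivM !mevalM.
move: (p.@[v]) (q.@[v]) (p'.@[v]) (q'.@[v]) (dderiv a p v) (dderiv a q v) (dderiv a p' v) (dderiv a q' v).
by move=> x y z t dx dy dz dt y0 t0; field; rewrite y0 t0.
Qed.

Lemma dfracZ a c p q v : dfrac a (c *: p) q v = c * dfrac a p q v.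
Proof.
rewrite /dfrac dderivZ mevalZ.
by move: (dderiv a p v) (dderiv a q v) (p.@[v]) (q.@[v]^-1) => x y r s; ring. Qed.

Lemma dderiv_scale a p k t v : p \is k.-homog -> t != 0 ->
  t * dderiv a p (fun i => t * v i) = t ^+ k * dderiv a p v.
Proof.
move=> hp t0; rewrite !mulr_sumr; apply: eq_bigr => j _.
have : forms (k%:Z - 1) p^`M(j) by exact: forms_mderiv.
case: k hp => [|k] hp; first by move=> /= ->; rewrite !meval0 !mulr0.
rewrite -addn1 PoszD addrK => hp'; rewrite (meval_scale _ _ hp') addn1 exprS.
by move: (a j) (_.@[v]) (t ^+ k) => c x y; ring.
Qed.

Lemma dfrac_scale a p q k t v : p \is k.-homog -> q \is k.-homog -> t != 0 ->
  dfrac a p q (fun i => t^-1 * v i) = dfrac (fun j => t * a j) p q v.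
Proof.
move=> hp hq t0; have t0' : t^-1 != 0 by rewrite invr_eq0.
have h r : r \is k.-homog -> dderiv a r (fun i => t^-1 * v i) = t * (t^-1 ^+ k * dderiv a r v).
  by move=> hr; rewrite -(dderiv_scale _ _ hr t0') mulrA divff // mul1r.
rewrite /dfrac !h // !dderiv_vscale !(meval_scale _ _ hp) !(meval_scale _ _ hq).
have u0 : t^-1 ^+ k != 0 by rewrite expf_neq0.
rewrite -mulf_div divff // mul1r.
have [->|q0] := eqVneq q.@[v] 0; first by rewrite !mulr0 invr0 !mulr0.
move: (t^-1 ^+ k) u0 => u u0; move: (p.@[v]) (q.@[v]) q0 (dderiv a p v) (dderiv a q v).
by move=> x y y0 dx dy; field; rewrite u0 y0.
Qed.

End Directional.

Section VectorFields.
Variables (R : realType) (f : {mpoly R[i][4]}) (d : nat).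
Local Notation C := R[i].
Local Notation V := ('I_4 -> C).
Local Notation fct := (V -> C^o).
Local Notation family := (set V -> fct -> fct).
Local Notation P := {mpoly C[4]}.
Hypotheses (d0 : (0 < d)%N) (smooth_f : smooth_hypersurface f d).

Lemma cone_multiple p : (forall v, pts f v -> p.@[v] = 0) <-> multiples f p.
Proof.
have [f0 hf sm] := smooth_f.
have := on_cone_multiple (@complex_uncountable R) f0 hf d0 (isT : (2 < 3)%N) sm p.
move=> [h1 h2]; split=> [hp|/h2 hp v [v0 fv]]; last exact: hp.
by apply: h1 => v v0 fv; apply: hp.
Qed.

(** Near [v] the numerators satisfy [g * (p * q' - p' * q) = f * r] with [g.@[v] != 0].
The right-hand side has derivative zero at [v] in a direction tangent to the cone. *)
Lemma dfrac_well_defined (a : V) W v p q p' q' : zopen f W -> W v -> dderiv a f v = 0 ->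
  (forall w, W w -> [/\ q.@[w] != 0, q'.@[w] != 0 & p.@[w] / q.@[w] = p'.@[w] / q'.@[w]]) ->
  dfrac a p q v = dfrac a p' q' v.
Proof.
move=> oW Wv ta h; have [g [k [hg gv gW]]] := zopen_basic_nbhd oW Wv.
have [r hr] : multiples f (g * (p * q' - p' * q)).
  apply/cone_multiple => u hu; rewrite mevalM.
  have [->|gu] := eqVneq g.@[u] 0; first by rewrite mul0r.
  have [qu qu' /eqP] := h u (gW u (conj hu gu)).
  by rewrite eqr_div // => /eqP E; rewrite mevalB !mevalM E subrr mulr0.
have [_ fv] := zopen_pts_sub oW Wv.
have [qv qv' E] := h v Wv.
have E' : p.@[v] * q'.@[v] = p'.@[v] * q.@[v] by apply/eqP; rewrite -eqr_div // E.
have : dderiv a (g * (p * q' - p' * q)) v = 0 by rewrite hr dderivM fv ta mul0r mulr0 addr0.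
rewrite dderivM mevalB !mevalM E' subrr mul0r addr0 => /eqP.
rewrite mulf_eq0 (negbTE gv) dderivB !dderivM /= => /eqP.
rewrite /dfrac E; move: E' qv qv'.
move: (p.@[v]) (q.@[v]) (p'.@[v]) (q'.@[v]) (dderiv a p v) (dderiv a q v) (dderiv a p' v) (dderiv a q' v).
move=> x y z t dx dy dz dt E' y0 t0 H.
apply/eqP; rewrite eqr_div //; apply/eqP.
have xE : x = z / t * y by rewrite mulrAC -E' mulfK.
have zE : z = z / t * t by rewrite divfK.
move: xE zE; move: (z / t) => m xE zE.
by move: H; rewrite xE zE => H; apply/eqP; rewrite -subr_eq0 -H; apply/eqP; ring.
Qed.

Definition local_fraction (W : set V) (s : fct) (v : V) (pq : P * P) : Prop :=
  exists W', [/\ zopen f W', W' v, W' `<=` W & exists l,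
    [/\ pq.1 \is l.-homog, pq.2 \is l.-homog &
      forall w, W' w -> pq.2.@[w] != 0 /\ s w = pq.1.@[w] / pq.2.@[w]]].

Definition chosen_fraction (W : set V) (s : fct) (v : V) : P * P :=
  xget (0, 1) (local_fraction W s v).

Lemma chosen_fractionP W s v : O_X f 0 W s -> W v ->
  local_fraction W s v (chosen_fraction W s v).
Proof.
move=> hs Wv; rewrite /chosen_fraction; case: xgetP => [pq -> //|no].
have [W' [oW' Wv' WW' [l [p [q [hp hq h]]]]]] := O_X_near hs Wv.
case: (no (p, q)); exists W'; split=> //; exists l; split=> //.
by rewrite addr0 in hp.
Qed.

(** The derivation [sum_j a_j d/dx_j].  The fraction in which the derivative is taken
does not depend on [a], so that [vfield] is linear on all vectors, tangent or not. *)
Definition vfield (a : 'I_4 -> P) : family := fun W s v =>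
  if `[< [/\ zopen f W, O_X f 0 W s & W v] >]
  then dfrac (fun j => (a j).@[v]) (chosen_fraction W s v).1 (chosen_fraction W s v).2 v
  else 0.

Lemma vfield_off a W s v : ~ [/\ zopen f W, O_X f 0 W s & W v] -> vfield a W s v = 0.
Proof. by move=> h; rewrite /vfield asboolF. Qed.

Lemma vfield_lin c a b : vfield (fun j => c *: a j + b j) = c *: vfield a + vfield b.
Proof.
apply/funext => W; apply/funext => s; apply/funext => v.
rewrite (_ : (c *: vfield a + vfield b) W s v = c * vfield a W s v + vfield b W s v) //.
rewrite /vfield; case: ifP => _; last by rewrite mulr0 addr0.
rewrite -dfrac_lin; congr (dfrac _ _ _ _); apply/funext => j.
by rewrite mevalD mevalZ.
Qed.

Definition tangent (a : 'I_4 -> P) : Prop := \sum_j a j * f^`M(j) = 0.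

Lemma tangent_dderiv a v : tangent a -> dderiv (fun j => (a j).@[v]) f v = 0.
Proof.
move=> /(congr1 (meval v)); rewrite raddf_sum meval0 => E; rewrite -[RHS]E.
by apply: eq_bigr => j _; rewrite /= mevalM.
Qed.

Lemma vfieldE a W s v W' p q : tangent a -> zopen f W -> O_X f 0 W s -> W v ->
  zopen f W' -> W' v -> (forall w, W' w -> q.@[w] != 0 /\ s w = p.@[w] / q.@[w]) ->
  vfield a W s v = dfrac (fun j => (a j).@[v]) p q v.
Proof.
move=> ta oW hs Wv oW' Wv' h; rewrite /vfield asboolT //.
have [W2 [oW2 Wv2 _ [l [_ _ h2]]]] := chosen_fractionP hs Wv.
apply: (dfrac_well_defined (W := W' `&` W2)) => //; [exact: zopenI | exact: tangent_dderiv | ].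
by move=> w [/h[qw <-] /h2[qw2 <-]].
Qed.

End VectorFields.

(** * Vector fields are derivations *)

Section VectorFieldsAreDerivations.
Variables (R : realType) (f : {mpoly R[i][4]}) (d : nat).
Local Notation C := R[i].
Local Notation V := ('I_4 -> C).
Local Notation fct := (V -> C^o).
Local Notation family := (set V -> fct -> fct).
Local Notation P := {mpoly C[4]}.
Hypotheses (d0 : (0 < d)%N) (smooth_f : smooth_hypersurface f d).

(** The quotient rule, with degrees. *)
Lemma dfrac_fraction e (a : 'I_4 -> P) (W : set V) l p q : (forall j, forms (e + 1) (a j)) ->
  p \is l.-homog -> q \is l.-homog -> (forall w, W w -> q.@[w] != 0) ->
  fraction_on e W (fun v => dfrac (fun j => (a j).@[v]) p q v).
Proof.
move=> ha hp hq h.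
have [Da [Dae hDa]] : exists Da : P -> P,
    (forall r v, (Da r).@[v] = dderiv (fun j => (a j).@[v]) r v) /\
    (forall r, r \is l.-homog -> forms (l%:Z + e) (Da r)).
  exists (fun r => \sum_j a j * r^`M(j)); split=> [r v|r hr].
    by rewrite raddf_sum; apply: eq_bigr => j _; rewrite /= mevalM.
  apply: forms_sum => j _.
  have := formsM_int (ha j) (forms_mderiv j (hr : forms l%:Z r)); congr forms; ring.
exists (l + l)%N, (q * Da p - p * Da q), (q * q); split=> [||w Ww].
- by apply: formsB; [have := formsM hq (hDa _ hp) | have := formsM hp (hDa _ hq)];
    rewrite PoszD; congr forms; ring.
- exact: dhomogM.
have qw := h w Ww; rewrite mevalB !mevalM !Dae mulf_neq0 //; split=> //.
rewrite /dfrac; move: (dderiv _ p w) (dderiv _ q w) (p.@[w]) (q.@[w]) qw => x y z t t0.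
by field.
Qed.

Lemma O_X_const (U : set V) (c : C) : zopen f U -> O_X f 0 U (restr U (fun=> c)).
Proof.
move=> oU; have hc : (c%:MP : P) \is 0.-homog.
  by rewrite -[c]mulr1 mpolyCM mpolyC1 mul_mpolyC; apply: dhomogZ; exact: dhomog1.
have h1 : (1 : P) \is 0.-homog by exact: dhomog1.
have := O_X_fraction (e := 0) oU (hc : forms (0%:Z + 0) c%:MP) h1.
have -> : (fun v : V => (c%:MP : P).@[v] / (1 : P).@[v]) = (fun=> c).
  by apply/funext => v; rewrite mevalC meval1 divr1.
by apply=> w _; rewrite meval1 oner_neq0.
Qed.

Lemma O_XZ e (U : set V) (c : C) (s : fct) : zopen f U -> O_X f e U s -> O_X f e U (c *: s).
Proof.
move=> oU hs; have := O_XM (O_X_const c oU) hs; rewrite add0r.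
have -> // : restr U (fun=> c) \* s = c *: s.
apply/funext => v /=; have [Uv|nUv] := pselect (U v); first by rewrite restrE.
by rewrite restr_off // mul0r [RHS](_ : _ = c * s v) // (O_X_off hs) // mulr0.
Qed.

Lemma local_fraction_pair (W : set V) (s t : fct) v : zopen f W -> O_X f 0 W s -> O_X f 0 W t ->
  W v -> exists W' p q p' q', [/\ zopen f W', W' v, W' `<=` W,
    (forall w, W' w -> q.@[w] != 0 /\ s w = p.@[w] / q.@[w]) &
    (forall w, W' w -> q'.@[w] != 0 /\ t w = p'.@[w] / q'.@[w])].
Proof.
move=> oW hs ht Wv.
have [W1 [o1 v1 s1 [l1 [_ _ h1]]]] := chosen_fractionP hs Wv.
have [W2 [o2 v2 s2 [l2 [_ _ h2]]]] := chosen_fractionP ht Wv.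
exists (W1 `&` W2), (chosen_fraction f W s v).1, (chosen_fraction f W s v).2,
  (chosen_fraction f W t v).1, (chosen_fraction f W t v).2.
by split=> //; [exact: zopenI | move=> w [/s1] | move=> w [/h1] | move=> w [_ /h2]].
Qed.

Lemma vfield_derivation e a : (forall j, forms (e + 1) (a j)) -> tangent f a ->
  derivations f e (pts f) (vfield f a).
Proof.
move=> ha ta; split.
- move=> W s oW _ hs; apply/O_XP; split=> v Wv; first by apply: vfield_off => -[].
  have [W1 [o1 v1 s1 [l [hp hq h1]]]] := chosen_fractionP hs Wv.
  exists W1; split=> //.
  apply: (fraction_on_eq _ (dfrac_fraction ha hp hq (fun w hw => (h1 w hw).1))).
  by move=> w W1w; rewrite (vfieldE d0 smooth_f ta oW hs (s1 _ W1w) o1 W1w h1).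
- move=> W W' s oW oW' W'W _ hs; apply/funext => v.
  have hs' := O_X_restr oW' W'W hs.
  have [Wv'|nWv'] := pselect (W' v); last first.
    by rewrite restr_off //; apply: vfield_off => -[].
  have [W1 [o1 v1 s1 [l [hp hq h1]]]] := chosen_fractionP hs' Wv'.
  have h1' w : W1 w -> _ := fun W1w =>
    eq_ind _ (fun y => _ /\ y = _) (h1 w W1w) _ (restrE s (s1 w W1w)).
  have E1 := vfieldE d0 smooth_f ta oW' hs' Wv' o1 v1 h1.
  have E2 := vfieldE d0 smooth_f ta oW hs (W'W _ Wv') o1 v1 h1'.
  exact: etrans E1 (esym (etrans (restrE _ Wv') E2)).
- move=> W c s t oW _ hs ht; apply/funext => v.
  have hst : O_X f 0 W (c *: s + t) by apply: O_XD => //; exact: O_XZ.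
  rewrite [RHS](_ : _ = c * vfield f a W s v + vfield f a W t v) //.
  have [Wv|nWv] := pselect (W v); last first.
    by rewrite !vfield_off ?mulr0 ?addr0 // => -[].
  have [W' [p [q [p' [q' [o' v' s' h h']]]]]] := local_fraction_pair oW hs ht Wv.
  rewrite (vfieldE d0 smooth_f ta oW hs Wv o' v' h) (vfieldE d0 smooth_f ta oW ht Wv o' v' h').
  rewrite (vfieldE (p := q' * (c *: p) + q * p') (q := q * q') d0 smooth_f ta oW hst Wv o' v').
    by rewrite dfracD ?dfracZ //; [case: (h v v') | case: (h' v v')].
  move=> w W'w; have [qw sw] := h w W'w; have [qw' tw] := h' w W'w.
  rewrite mevalD !mevalM mulf_neq0 // (_ : (c *: s + t) w = c * s w + t w) // sw tw.
  rewrite mulrA -mevalZ addf_div //.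
  by rewrite [(c *: p).@[w] * _]mulrC [p'.@[w] * _]mulrC.
- move=> W s t oW _ hs ht; apply/funext => v /=.
  have hst : O_X f 0 W (s \* t) by have := O_XM hs ht; rewrite addr0.
  rewrite [RHS](_ : _ = s v * vfield f a W t v + t v * vfield f a W s v) //.
  have [Wv|nWv] := pselect (W v); last first.
    by rewrite !vfield_off ?mulr0 ?addr0 // => -[].
  have [W' [p [q [p' [q' [o' v' s' h h']]]]]] := local_fraction_pair oW hs ht Wv.
  rewrite (vfieldE d0 smooth_f ta oW hs Wv o' v' h) (vfieldE d0 smooth_f ta oW ht Wv o' v' h').
  rewrite (vfieldE (p := p * p') (q := q * q') d0 smooth_f ta oW hst Wv o' v').
    by have [qv ->] := h v v'; have [qv' ->] := h' v v'; rewrite dfracM.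
  move=> w W'w; have [qw sw] := h w W'w; have [qw' tw] := h' w W'w.
  by rewrite !mevalM mulf_neq0 //= sw tw mulf_div.
- move=> W s h; apply/funext => v; apply: vfield_off => -[oW hs Wv]; apply: h; split=> //.
  exact: zopen_pts_sub.
Qed.

Lemma derivation_scale e e' (U U' : set V) (D : family) (h : fct) :
  zopen f U' -> U' `<=` U -> derivations f e U D -> O_X f e' U' h ->
  derivations f (e' + e) U' (fun W s =>
    if `[< [/\ zopen f W, W `<=` U' & O_X f 0 W s] >] then h \* D W s else 0).
Proof.
move=> oU' UU' [D1 D2 D3 D4 D5] hh.
have WU W : W `<=` U' -> W `<=` U by move=> WU' w /WU' /UU'.
split=> [W s oW WU' hs|W W' s oW oW' W'W WU' hs|W c s t oW WU' hs ht|W s t oW WU' hs ht|W s no].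
- rewrite asboolT //.
  have -> : h \* D W s = restr W h \* D W s.
    apply/funext => v /=; have [Wv|nWv] := pselect (W v); first by rewrite restrE.
    by rewrite (O_X_off (D1 W s oW (WU _ WU') hs)) ?mulr0.
  by apply: O_XM; [exact: O_X_restr hh | apply: D1 => //; exact: WU].
- have hs' := O_X_restr oW' W'W hs.
  rewrite !asboolT //; last by split=> // w /W'W /WU'.
  rewrite (D2 W W') //; last exact: WU.
  apply/funext => v /=; have [Wv'|nWv'] := pselect (W' v); first by rewrite !restrE.
  by rewrite !restr_off ?mulr0.
- have hst : O_X f 0 W (c *: s + t) by apply: O_XD => //; exact: O_XZ.
  rewrite !asboolT // D3 //; last exact: WU.
  apply/funext => v; rewrite /= [RHS](_ : _ = c * (h v * D W s v) + h v * D W t v) //.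
  rewrite (_ : (c *: D W s + D W t) v = c * D W s v + D W t v) // mulrDr mulrCA //.
- have hst : O_X f 0 W (s \* t) by have := O_XM hs ht; rewrite addr0.
  rewrite !asboolT // D4 //; last exact: WU.
  apply/funext => v; rewrite /= [RHS](_ : _ = s v * (h v * D W t v) + t v * (h v * D W s v)) //.
  rewrite (_ : (s \* D W t + t \* D W s) v = s v * D W t v + t v * D W s v) // mulrDr.
  by rewrite mulrCA [h v * (t v * _)]mulrCA.
- by rewrite asboolF.
Qed.

(** On the chart [x_i != 0], the function [x_i ^ e]. *)
Lemma invertible_section e (i : 'I_4) : exists g h : fct,
  [/\ O_X f e (basic_open f 'X_i) g, O_X f (- e) (basic_open f 'X_i) h &
   forall v, basic_open f 'X_i v -> g v * h v = 1].
Proof.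
have oU := zopen_basic f (homogX C i).
have hX k : ('X_i : P) ^+ k \is k.-homog by have := dhomogMn k (homogX C i); rewrite mul1n.
have h1 : (1 : P) \is 0.-homog by exact: dhomog1.
have n0 k w : basic_open f 'X_i w -> (('X_i : P) ^+ k).@[w] != 0.
  by move=> [_ wi]; rewrite rmorphXn /= expf_neq0.
have n1 w : basic_open f 'X_i w -> (1 : P).@[w] != 0 by rewrite meval1 oner_neq0.
have inv k w : basic_open f 'X_i w ->
    (('X_i : P) ^+ k).@[w] / (1 : P).@[w] * ((1 : P).@[w] / (('X_i : P) ^+ k).@[w]) = 1.
  by move=> Ww; rewrite meval1 divr1 mul1r divff // n0.
case: e => k.
  exists (restr (basic_open f 'X_i) (fun v => ('X_i ^+ k).@[v] / (1 : P).@[v])),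
         (restr (basic_open f 'X_i) (fun v => (1 : P).@[v] / ('X_i ^+ k).@[v])); split.
  - by apply: (O_X_fraction (l := 0)) => //; rewrite add0r; exact: hX.
  - by apply: (O_X_fraction (l := k)) => //; [rewrite subrr | exact: n0].
  - by move=> v Uv; rewrite !restrE // inv.
exists (restr (basic_open f 'X_i) (fun v => (1 : P).@[v] / ('X_i ^+ k.+1).@[v])),
       (restr (basic_open f 'X_i) (fun v => ('X_i ^+ k.+1).@[v] / (1 : P).@[v])); split.
- by apply: (O_X_fraction (l := k.+1)) => //; [rewrite NegzE subrr | exact: n0].
- by apply: (O_X_fraction (l := 0)) => //; rewrite add0r NegzE opprK; exact: hX.
- by move=> v Uv; rewrite !restrE // mulrC inv.
Qed.

(** On the chart [x_i != 0] a derivation into O_X(e) is [x_i ^ e] times the derivation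
[x_i ^ (- e) * D] into O_X. *)
Lemma Theta_twistE e : Theta_twist f e (pts f) = derivations f e (pts f).
Proof.
apply/seteqP; split=> [D []//|D hD]; split=> // v hv.
have [v0 _] := hv; have [i vi] := nonzero_coordinate v0.
pose U := basic_open f 'X_i; have oU : zopen f U := zopen_basic f (homogX C i).
have [g [h [hg hh gh]]] := invertible_section e i.
have Usub : U `<=` pts f by apply: zopen_pts_sub.
exists U; split=> //; first by split=> //; rewrite mevalXU.
exists 1%N, (fun _ W s => if `[< [/\ zopen f W, W `<=` U & O_X f 0 W s] >] then h \* D W s else 0),
  (fun _ => g); split=> // [_|W s oW WU hs].
  by have := derivation_scale oU Usub hD hh; rewrite addNr.
rewrite big_ord1 asboolT //; apply/funext => w /=.
have [D1 _ _ _ _] := hD.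
have [Ww|nWw] := pselect (W w); first by rewrite mulrA gh ?mul1r //; exact: WU.
by rewrite (O_X_off (D1 W s oW _ hs)) ?mulr0 // => u /WU /Usub.
Qed.

End VectorFieldsAreDerivations.

(** * Derivations on the affine charts *)

Section AffineCharts.
Variables (R : realType) (f : {mpoly R[i][4]}).
Local Notation C := R[i].
Local Notation V := ('I_4 -> C).
Local Notation fct := (V -> C^o).
Local Notation family := (set V -> fct -> fct).
Local Notation P := {mpoly C[4]}.

Section OneDerivation.
Variables (e : int) (D : family).
Hypothesis hD : derivations f e (pts f) D.
Local Notation U i := (basic_open f ('X_i : P)).

Lemma open_chart i : zopen f (U i).
Proof. exact: zopen_basic (homogX _ i). Qed.

Lemma chartP i v : pts f v -> v i != 0 -> U i v.
Proof. by move=> hv vi; split=> //; rewrite mevalXU. Qed.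

Lemma derivation_section W s : zopen f W -> O_X f 0 W s -> O_X f e W (D W s).
Proof. by move=> oW; case: hD => h _ _ _ _; apply: h => //; exact: zopen_pts_sub. Qed.

Lemma derivation_restr W W' s v : zopen f W -> zopen f W' -> W' `<=` W -> O_X f 0 W s ->
  W' v -> D W' (restr W' s) v = D W s v.
Proof.
move=> oW oW' W'W hs Wv; case: hD => _ h _ _ _.
by rewrite (h W W') ?restrE //; exact: zopen_pts_sub.
Qed.

Lemma derivationD W s t v : zopen f W -> O_X f 0 W s -> O_X f 0 W t ->
  D W (s + t) v = D W s v + D W t v.
Proof.
move=> oW hs ht; case: hD => _ _ h _ _; have := h W 1 s t oW (zopen_pts_sub oW) hs ht.
by rewrite !scale1r => ->.
Qed.

Lemma derivation0 W v : zopen f W -> O_X f 0 W 0 -> D W 0 v = 0.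
Proof.
move=> oW h; have := derivationD v oW h h; rewrite addr0 => /eqP.
by rewrite -subr_eq0 opprD addrA subrr sub0r oppr_eq0 => /eqP.
Qed.

Lemma derivationM W s t v : zopen f W -> O_X f 0 W s -> O_X f 0 W t ->
  D W (s \* t) v = s v * D W t v + t v * D W s v.
Proof.
by move=> oW hs ht; case: hD => _ _ _ h _; rewrite (h W s t oW (zopen_pts_sub oW) hs ht).
Qed.

Lemma derivation_const W c v : zopen f W -> W v -> D W (restr W (fun=> c)) v = 0.
Proof.
move=> oW Wv; have h1 := O_X_const 1 oW; have hz := O_X_const 0 oW.
have r0 : restr W (fun=> 0) = 0 :> fct.
  apply/funext => u; have [Wu|nWu] := pselect (W u); first by rewrite restrE.
  by rewrite restr_off.
rewrite r0 in hz.
have D1 : D W (restr W (fun=> 1)) v = 0.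
  have E : restr W (fun=> 1) \* restr W (fun=> 1) = restr W (fun=> 1) :> fct.
    apply/funext => u /=; have [Wu|nWu] := pselect (W u); first by rewrite restrE // mul1r.
    by rewrite restr_off // mul0r.
  have := derivationM v oW h1 h1; rewrite E restrE // mul1r => /eqP.
  by rewrite -subr_eq0 opprD addrA subrr sub0r oppr_eq0 => /eqP.
have E : restr W (fun=> c) = c *: restr W (fun=> 1) + 0 :> fct.
  rewrite addr0; apply/funext => u.
  rewrite (_ : (c *: restr W (fun=> 1)) u = c * restr W (fun=> 1) u) //.
  have [Wu|nWu] := pselect (W u); first by rewrite !restrE // mulr1.
  by rewrite !restr_off // mulr0.
case: (hD) => _ _ h _ _; rewrite E (h W c _ _ oW (zopen_pts_sub oW) h1 hz).
rewrite (_ : (c *: D W (restr W (fun=> 1)) + D W 0) v =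
  c * D W (restr W (fun=> 1)) v + D W 0 v) //.
by rewrite D1 mulr0 add0r derivation0.
Qed.

(** The function given by [p] on the chart [x_i != 0], in the affine coordinates
[x_j / x_i]. *)
Definition dehom (i : 'I_4) (p : P) : fct := restr (U i) (fun v => p.@[fun j => (v i)^-1 * v j]).

Definition delta (i j : 'I_4) : fct := D (U i) (dehom i 'X_j).

Lemma dehom_section i p : O_X f 0 (U i) (dehom i p).
Proof.
elim/mpoly_ring_ind: p => [c|j|p q hp hq|p q hp hq].
- rewrite /dehom (_ : (fun v => _) = fun=> c); first exact: O_X_const (open_chart i).
  by apply/funext => v; rewrite mevalC.
- have := O_X_fraction (f := f) (l := 1) (e := 0) (open_chart i)
    (homogX C j : forms (1%:Z + 0) 'X_j) (homogX C i).
  have -> : restr (U i) (fun v => ('X_j : P).@[v] / ('X_i : P).@[v]) = dehom i 'X_j.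
    by congr restr; apply/funext => v; rewrite !mevalXU mulrC.
  by apply=> w [].
- rewrite (_ : dehom i (p + q) = dehom i p + dehom i q); first exact: O_XD.
  apply/funext => v; rewrite [RHS](_ : _ = dehom i p v + dehom i q v) //.
  have [Uv|nUv] := pselect (U i v); first by rewrite /dehom !restrE // mevalD.
  by rewrite /dehom !restr_off // addr0.
- rewrite (_ : dehom i (p * q) = dehom i p \* dehom i q).
    by have := O_XM hp hq; rewrite addr0.
  apply/funext => v /=.
  have [Uv|nUv] := pselect (U i v); first by rewrite /dehom !restrE // mevalM.
  by rewrite /dehom !restr_off // mulr0.
Qed.

(** Both sides are derivations in [p] that agree on constants and on the variables. *)
Lemma derivation_dehom i p v : U i v ->
  D (U i) (dehom i p) v = dderiv (fun j => delta i j v) p (fun j => (v i)^-1 * v j).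
Proof.
move=> Uv; elim/mpoly_ring_ind: p => [c|j|p q hp hq|p q hp hq].
- rewrite dderivC /dehom (_ : (fun v => _) = fun=> c).
    exact: derivation_const (open_chart i) Uv.
  by apply/funext => w; rewrite mevalC.
- by rewrite dderivX.
- rewrite dderivD -hp -hq -derivationD; [|exact: open_chart|exact: dehom_section..].
  congr (D _ _ _); apply/funext => u; rewrite [RHS](_ : _ = dehom i p u + dehom i q u) //.
  have [Uu|nUu] := pselect (U i u); first by rewrite /dehom !restrE // mevalD.
  by rewrite /dehom !restr_off // addr0.
- rewrite dderivM -hp -hq.
  have E r : dehom i r v = r.@[fun j => (v i)^-1 * v j] by rewrite /dehom restrE.
  rewrite -!E -derivationM; [|exact: open_chart|exact: dehom_section..].
  congr (D _ _ _); apply/funext => u /=.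
  have [Uu|nUu] := pselect (U i u); first by rewrite /dehom !restrE // mevalM.
  by rewrite /dehom !restr_off // mulr0.
Qed.

(** Dehomogenize: [s] is the quotient of two polynomials in the [x_j / x_i], and the
Leibniz rule for [s * q = p] determines [D s]. *)
Lemma derivation_formula W s W' v i l p q : zopen f W -> O_X f 0 W s ->
  zopen f W' -> W' v -> W' `<=` W -> p \is l.-homog -> q \is l.-homog ->
  (forall w, W' w -> q.@[w] != 0 /\ s w = p.@[w] / q.@[w]) -> v i != 0 ->
  D W s v = dfrac (fun j => v i * delta i j v) p q v.
Proof.
move=> oW hs oW' Wv' W'W hp hq h vi.
have hv : pts f v := zopen_pts_sub oW' Wv'.
pose W2 := W' `&` U i; have oW2 : zopen f W2 by apply: zopenI => //; exact: open_chart.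
have W2v : W2 v by split=> //; exact: chartP.
have W2W : W2 `<=` W by move=> w [/W'W].
have W2U : W2 `<=` U i by move=> w [].
have hde r := O_X_restr oW2 W2U (dehom_section i r).
have E : restr W2 s \* restr W2 (dehom i q) = restr W2 (dehom i p).
  apply/funext => w /=; have [Ww|nWw] := pselect (W2 w); last by rewrite !restr_off // mulr0.
  rewrite !restrE // /dehom !restrE; [|exact: W2U..].
  have [_ wi] := Ww.2; rewrite mevalXU in wi.
  have [qw ->] := h w Ww.1; rewrite (meval_scale _ _ hp) (meval_scale _ _ hq).
  by rewrite mulrCA divfK.
have := derivationM v oW2 (O_X_restr oW2 W2W hs) (hde q); rewrite E.
rewrite !(derivation_restr (v := v) (open_chart i) oW2 W2U (dehom_section i _)) //.
rewrite (derivation_restr oW oW2 W2W hs W2v) !restrE // !derivation_dehom; [|exact: chartP..].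
rewrite -(dfrac_scale _ _ hp hq vi) /dfrac {1}/dehom restrE; last exact: chartP.
have [qv sv] := h v Wv'.
have vi' : (v i)^-1 ^+ l != 0 by rewrite expf_neq0 ?invr_eq0.
have -> : p.@[fun j => (v i)^-1 * v j] / q.@[fun j => (v i)^-1 * v j] = s v.
  by rewrite (meval_scale _ _ hp) (meval_scale _ _ hq) -mulf_div divff // mul1r sv.
have qv' : q.@[fun j => (v i)^-1 * v j] != 0 by rewrite (meval_scale _ _ hq) mulf_neq0.
by move=> ->; rewrite addrAC subrr add0r mulrC mulKf.
Qed.

(** The derivative of [x_j / x_i], computed on the chart [x_l != 0]. *)
Lemma delta_change i j l v : pts f v -> v i != 0 -> v l != 0 ->
  v i * delta i j v = v l * delta l j v - v j / v i * (v l * delta l i v).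
Proof.
move=> hv vi vl.
have Uv : U i v by apply: chartP.
rewrite /delta (derivation_formula (W' := U i) (p := 'X_j) (q := 'X_i) (l := 1) (i := l)
  (open_chart i) (dehom_section i 'X_j) (open_chart i) Uv _ (homogX _ _) (homogX _ _)) //.
  by rewrite /dfrac !dderivX !mevalXU mulrC divfK.
move=> w Uw; have [_ wi] := Uw; split=> //.
by rewrite /dehom restrE // !mevalXU mulrC.
Qed.

(** The coordinate [(j, k)] of the bivector [x /\ theta], where [theta] is the field that
represents the derivation on the chart [x_i != 0].  On another chart [theta] changes
by a multiple of [x], which does not affect the bivector. *)
Definition omega_at (i j k : 'I_4) (v : V) : C :=
  v i * (v j * delta i k v - v k * delta i j v).

Lemma omega_change i l j k v : pts f v -> v i != 0 -> v l != 0 ->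
  omega_at i j k v = omega_at l j k v.
Proof.
move=> hv vi vl.
have E m : delta i m v = (v i)^-1 * (v l * delta l m v - v m / v i * (v l * delta l i v)).
  by rewrite -delta_change // mulKf.
rewrite /omega_at !E.
move: (v i) vi (v l) (v j) (v k) (delta l k v) (delta l j v) (delta l i v).
by move=> x x0 y z t a b c; field.
Qed.

End OneDerivation.
End AffineCharts.

(** * Derivations are vector fields *)

Section Globalization.
Variables (R : realType) (f : {mpoly R[i][4]}) (d : nat).
Local Notation C := R[i].
Local Notation V := ('I_4 -> C).
Local Notation fct := (V -> C^o).
Local Notation family := (set V -> fct -> fct).
Local Notation P := {mpoly C[4]}.
Hypotheses (d0 : (0 < d)%N) (smooth_f : smooth_hypersurface f d).

(** Multiplying by a form that vanishes off the open set where the fraction is valid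
gives an identity on the whole cone. *)
Lemma O_X_denominator e U s v : O_X f e U s -> U v -> exists h r : P,
  h.@[v] != 0 /\ forall u, pts f u -> h.@[u] * s u = r.@[u].
Proof.
move=> hs Uv; have [W [oW Wv _ [l [p [q [_ _ h]]]]]] := O_X_near hs Uv.
have [g [k [_ gv gW]]] := zopen_basic_nbhd oW Wv; have [qv _] := h v Wv.
exists (g * q), (g * p); rewrite mevalM mulf_neq0 //; split=> // u hu; rewrite !mevalM.
have [->|gu] := eqVneq g.@[u] 0; first by rewrite !mul0r.
by have [qu ->] := h u (gW u (conj hu gu)); rewrite -mulrA [q.@[u] * _]mulrC divfK.
Qed.

Section OneDerivation.
Variables (e : int) (D : family).
Hypothesis hD : derivations f e (pts f) D.

Lemma delta_section i j : O_X f e (basic_open f 'X_i) (delta f D i j).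
Proof. by apply: (derivation_section hD); [exact: open_chart | exact: dehom_section]. Qed.

Lemma derivation_form j k : exists2 w : P, forms (e + 1 + 1) w &
  forall i v, pts f v -> v i != 0 -> omega_at f D i j k v = w.@[v].
Proof.
have [f0 hf sm] := smooth_f.
pose s (v : V) : C := if [pick i | v i != 0] is Some i then omega_at f D i j k v else 0.
have sE i v : pts f v -> v i != 0 -> s v = omega_at f D i j k v.
  move=> hv vi; rewrite /s; case: pickP => [l vl|/(_ i)]; last by rewrite vi.
  exact: (omega_change hD).
have scone : on_cone f (fun v => exists h r : P, h.@[v] != 0 /\
    on_cone f (fun u => h.@[u] * s u = r.@[u])).
  move=> v v0 fv; have [i vi] := nonzero_coordinate v0; have hv : pts f v by [].
  have [h1 [r1 [h1v hr1]]] := O_X_denominator (delta_section i j) (chartP hv vi).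
  have [h2 [r2 [h2v hr2]]] := O_X_denominator (delta_section i k) (chartP hv vi).
  exists ('X_i * (h1 * h2)), ('X_i * ('X_i * ('X_j * h1 * r2 - 'X_k * h2 * r1))).
  rewrite !mevalM mevalXU !mulf_neq0 //; split=> // u u0 fu; have hu : pts f u by [].
  rewrite !mevalM mevalB !mevalM !mevalXU.
  (* Off the chart both sides vanish thanks to the factor ['X_i]. *)
  have [->|ui] := eqVneq (u i) 0; first by rewrite !mul0r.
  rewrite (sE i) // /omega_at -hr1 // -hr2 //.
  move: (u i) (u j) (u k) (h1.@[u]) (h2.@[u]) (delta f D i j u) (delta f D i k u).
  by move=> x y z a b c t; ring.
have [p hp] := global_function (@complex_uncountable R) f0 hf d0 (isT : (2 < 3)%N) sm scone.
exists (form_part (e + 1 + 1) p) => [|i v hv vi]; first exact: form_partP.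
rewrite -(sE i v hv vi); have [v0 fv] := hv.
apply: (homogeneous_function hf (s := s)) => // u u0 fu a a0.
have [l ul] := nonzero_coordinate u0; have hu : pts f u by [].
have hau := pts_scale hf a0 hu.
rewrite !(sE l) ?mulf_neq0 // /omega_at.
rewrite !(O_X_scale _ hf (open_chart f l) (delta_section l _) a0).
rewrite !expfzDr // expr1z.
move: (a ^ e) (u l) (u j) (u k) (delta f D l j u) (delta f D l k u) => x y z t b c.
by ring.
Qed.

End OneDerivation.

(** Apply the derivation to [f / x_i ^ d], which is the function 0. *)
Lemma delta_tangent e D i v : derivations f e (pts f) D -> pts f v -> v i != 0 ->
  dderiv (fun j => v i * delta f D i j v) f v = 0.
Proof.
move=> hD hv vi; have [f0 hf sm] := smooth_f.
have Uv := chartP hv vi; have oU := open_chart f i; have hz := O_X_const 0 oU.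
have hq : ('X_i : P) ^+ d \is d.-homog by have := dhomogMn d (homogX C i); rewrite mul1n.
have n0 w : basic_open f 'X_i w -> (('X_i : P) ^+ d).@[w] != 0.
  by move=> [_ wi]; rewrite rmorphXn /= expf_neq0.
have := derivation_formula hD oU hz oU Uv (fun _ h => h) hf hq _ vi.
rewrite (derivation_const hD 0 oU Uv) /dfrac; have [_ ->] := hv.
rewrite !mul0r subr0 => E.
have /esym/eqP : 0 = dderiv (fun j => v i * delta f D i j v) f v / ('X_i ^+ d).@[v].
  apply: E => w Uw; split; first exact: n0.
  by rewrite restrE //; have [[_ ->] _] := Uw; rewrite mul0r.
by rewrite mulf_eq0 invr_eq0 (negbTE (n0 v Uv)) orbF => /eqP.
Qed.

(** The bivectors of the derivation are given by forms [Om], and [Om = x /\ a] modulo [f]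
by [koszul_cocycle2].  At each point [a] differs from the field [b] of a chart by a
multiple of [x], so that [a . grad f] vanishes on the cone and equals [f * r].
Subtracting [r * x] divided by the degree makes [a] tangent, by Euler's formula, and
multiples of [x] do not act on fractions of degree 0. *)
Theorem derivation_is_vfield e D : derivations f e (pts f) D ->
  exists a, [/\ forall j, forms (e + 1) (a j), tangent f a & D = vfield f a].
Proof.
move=> hD; have [f0 hf sm] := smooth_f.
have /choice[Om hOm] (jk : 'I_4 * 'I_4) : exists w : P, forms (e + 1 + 1) w /\
    forall i v, pts f v -> v i != 0 -> omega_at f D i jk.1 jk.2 v = w.@[v].
  by have [w hw hw'] := derivation_form hD jk.1 jk.2; exists w.
pose b i v : V := fun j => v i * delta f D i j v.
have bE i j k v : pts f v -> v i != 0 -> v j * b i v k - v k * b i v j = (Om (j, k)).@[v].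
  move=> hv vi; have [_ E] := hOm (j, k); rewrite -(E i v hv vi) /omega_at /b /=.
  by move: (v i) (v j) (v k) (delta f D i j v) (delta f D i k v) => *; ring.
have [||a ha aOm] := @koszul_cocycle2 _ 3 f d f0 hf isT (e + 1) (fun j k => Om (j, k)).
- by move=> j k; have [] := hOm (j, k).
- move=> j k l; apply/(cone_multiple d0 smooth_f) => v hv; have [v0 _] := hv.
  have [i vi] := nonzero_coordinate v0.
  rewrite mevalD mevalB !mevalM !mevalXU -!(bE i) //.
  by move: (v j) (v k) (v l) (b i v j) (b i v k) (b i v l) => *; ring.
have aE i j v : pts f v -> v i != 0 ->
    (a j).@[v] = ((a i).@[v] - b i v i) / v i * v j + b i v j.
  move=> hv vi; have /(cone_multiple d0 smooth_f)/(_ v hv) := aOm i j.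
  rewrite !mevalB !mevalM !mevalXU -(bE i) // => /eqP; rewrite subr_eq0 => /eqP E.
  apply: (mulfI vi); rewrite mulrDr mulrA [v i * (_ / _)]mulrC divfK //.
  move: E; move: (v i) (v j) (b i v i) (b i v j) ((a i).@[v]) ((a j).@[v]) => x y z t u w E.
  by rewrite -(subrK (y * u) (x * w)) -E; ring.
have form_sum : forms (e + d%:Z) (\sum_j a j * f^`M(j)).
  apply: forms_sum => j _; have := formsM_int (ha j) (forms_mderiv j (hf : forms d%:Z f)).
  by congr forms; ring.
have [|r hr E] := @graded_multiple _ 3 f d hf (e + d%:Z) _ 0 _ form_sum.
  rewrite subr0; apply/(cone_multiple d0 smooth_f) => v hv; have [v0 fv] := hv.
  have [i vi] := nonzero_coordinate v0.
  have -> : (\sum_j a j * f^`M(j)).@[v] = dderiv (fun j => (a j).@[v]) f v.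
    by rewrite raddf_sum; apply: eq_bigr => j _; rewrite /= mevalM.
  rewrite (_ : (fun j => (a j).@[v]) =
      fun j => ((a i).@[v] - b i v i) / v i * v j + b i v j); last first.
    by apply/funext => j; exact: aE.
  by rewrite dderiv_lin (dderiv_euler _ hf) fv mul0rn mulr0 add0r (delta_tangent hD).
rewrite form_part0 add0r in E; rewrite addrK in hr.
(* Euler's formula gives the factor [d]. *)
pose a' j := a j - d%:R^-1 *: (r * 'X_j).
have dn0 : (d%:R : C) != 0 by rewrite pnatr_eq0 -lt0n.
have ta' : tangent f a'.
  rewrite /tangent /a'; under eq_bigr do rewrite mulrBl -scalerAl -mulrA.
  rewrite sumrB E -scaler_sumr -mulr_sumr (euler hf) mulrnAr.
  have -> : r * f *+ d = (d%:R : C) *: (r * f) by rewrite scaler_nat.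
  rewrite scalerA mulVf //.
  by rewrite scale1r mulrC subrr.
exists a'; split=> //.
  move=> j; apply: formsB => //; apply: formsZ.
  exact: (formsM_int hr (homogX C j : forms 1%:Z 'X_j)).
apply/funext => W; apply/funext => s; apply/funext => v.
have [[oW hs Wv]|no] := pselect [/\ zopen f W, O_X f 0 W s & W v]; last first.
  rewrite vfield_off //.
  have [[oW hs]|no'] := pselect (zopen f W /\ O_X f 0 W s).
    apply: O_X_off (derivation_section hD oW hs) _ => Wv; exact: no.
  by case: hD => _ _ _ _ -> // -[oW _ hs]; apply: no'.
have [W1 [o1 v1 s1 [l [hp hq h1]]]] := chosen_fractionP hs Wv.
have hv := zopen_pts_sub oW Wv; have [v0 _] := hv; have [i vi] := nonzero_coordinate v0.
rewrite (derivation_formula hD oW hs o1 v1 s1 hp hq h1 vi).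
rewrite (vfieldE d0 smooth_f ta' oW hs Wv o1 v1 h1).
rewrite (_ : (fun j => (a' j).@[v]) = fun j =>
    (((a i).@[v] - b i v i) / v i - d%:R^-1 * r.@[v]) * v j + b i v j).
  by rewrite dfrac_lin (dfrac_euler hp hq (h1 v v1).1) mulr0 add0r.
apply/funext => j; rewrite /a' mevalB mevalZ mevalM mevalXU (aE i) //.
move: ((a i).@[v] - b i v i) => t.
by rewrite mulrBl -[d%:R^-1 * _ * _]mulrA addrAC.
Qed.

End Globalization.

(** * The kernel and nonzero vector fields *)

Section Kernel.
Variables (R : realType) (f : {mpoly R[i][4]}) (d : nat).
Local Notation C := R[i].
Local Notation V := ('I_4 -> C).
Local Notation fct := (V -> C^o).
Local Notation family := (set V -> fct -> fct).
Local Notation P := {mpoly C[4]}.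
Hypotheses (d0 : (0 < d)%N) (smooth_f : smooth_hypersurface f d).

(** Test the field on the functions [x_j / x_i]. *)
Lemma vfield_eq0_minors a : tangent f a -> vfield f a = 0 ->
  forall i j, multiples f ('X_i * a j - 'X_j * a i).
Proof.
move=> ta a0 i j; apply/(cone_multiple d0 smooth_f) => v hv.
rewrite mevalB !mevalM !mevalXU.
have minor k l : v k != 0 -> v k * (a l).@[v] = v l * (a k).@[v].
  move=> vk; have Uv := chartP hv vk; have oU := open_chart f k.
  have hs := dehom_section f k 'X_l.
  have h w : basic_open f 'X_k w -> ('X_k : P).@[w] != 0 /\
      dehom f k 'X_l w = ('X_l : P).@[w] / ('X_k : P).@[w].
    by move=> Uw; split; [case: Uw | rewrite /dehom restrE // !mevalXU mulrC].
  have := vfieldE d0 smooth_f ta oU hs Uv oU Uv h.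
  rewrite a0 /dfrac !dderivX !mevalXU => /esym/eqP.
  rewrite mulf_eq0 invr_eq0 (negbTE vk) orbF subr_eq0 => /eqP ->.
  by rewrite mulrA [v k * _]mulrC divfK.
have [vi|vi] := eqVneq (v i) 0; last by rewrite minor // subrr.
have [vj|vj] := eqVneq (v j) 0; first by rewrite vi vj !mul0r subrr.
by rewrite -minor // subrr.
Qed.

Lemma vfield_eq0P e a : (forall j, forms (e + 1) (a j)) -> tangent f a ->
  (vfield f a = 0 <-> exists c w, [/\ forms e c, forall j, forms (e + 1 - d%:Z) (w j) &
     forall j, a j = c * 'X_j + f * w j]).
Proof.
have [f0 hf sm] := smooth_f; move=> ha ta; split=> [a0|[c [w [_ _ aE]]]].
  exact: (@koszul_cocycle1 _ 3 f d f0 hf isT e a ha (vfield_eq0_minors ta a0)).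
apply/funext => W; apply/funext => s; apply/funext => v.
have [[oW hs Wv]|no] := pselect [/\ zopen f W, O_X f 0 W s & W v]; last exact: vfield_off.
have [W1 [o1 v1 s1 [l [hp hq h1]]]] := chosen_fractionP hs Wv.
rewrite (vfieldE d0 smooth_f ta oW hs Wv o1 v1 h1).
have [_ fv] := zopen_pts_sub oW Wv.
rewrite (_ : (fun j => (a j).@[v]) = fun j => c.@[v] * v j); last first.
  by apply/funext => j; rewrite aE mevalD !mevalM mevalXU fv mul0r addr0.
by rewrite dfrac_vscale (dfrac_euler hp hq (h1 v v1).1) mulr0.
Qed.

Lemma multiples_half (x y z : P) : multiples f (x + y) -> multiples f (x + z) ->
  multiples f (y + z) -> multiples f x.
Proof.
move=> h1 h2 h3; have M := multiples_ideal f.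
have : multiples f (x + y + (x + z) - (y + z)).
  by apply: idealB => //; exact: idealD.
have -> : x + y + (x + z) - (y + z) = (2%:R : C) *: x.
  by rewrite scaler_nat mulr2n; ring.
move/(idealM M (2%:R^-1)%:MP); rewrite mul_mpolyC scalerA mulVf ?scale1r // pnatr_eq0 //.
Qed.

Lemma avoid2 (i k : 'I_4) : exists j, j != i /\ j != k.
Proof.
have /card_gt0P[j] : (0 < #|~: [set i; k]%SET|)%N.
  by have := cardsC [set i; k]%SET; rewrite card_ord cards2; case: (i != k); lia.
by rewrite !inE negb_or => /andP[ji jk]; exists j.
Qed.

Lemma gradient_degree i : f^`M(i) \is d.-1.-homog.
Proof.
have [_ hf _] := smooth_f; have : forms (d%:Z - 1) f^`M(i) by exact: forms_mderiv.
by have -> : d%:Z - 1 = d.-1%:Z by move: d0; lia.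
Qed.

(** The field [h * (f_j d_i - f_i d_j)], the simplest syzygies of the gradient. *)
Definition rotation (h : P) (i j : 'I_4) : 'I_4 -> P :=
  fun k => h * ((k == i)%:R * f^`M(j) - (k == j)%:R * f^`M(i)).

Lemma rotation_tangent h i j : tangent f (rotation h i j).
Proof.
have orth (g : 'I_4 -> P) : \sum_k h * ((k == i)%:R * g j - (k == j)%:R * g i) * g k = 0.
  have E l (u : P) : \sum_k (k == l)%:R * u * g k = u * g l.
    rewrite (bigD1 l) //= eqxx mul1r big1 ?addr0 // => k /negbTE ->.
    by rewrite !mul0r.
  under eq_bigr do rewrite -mulrA mulrBl.
  by rewrite -mulr_sumr sumrB !E [X in _ - X]mulrC subrr mulr0.
exact: (orth (fun k => f^`M(k))).
Qed.

Lemma rotation_degree n h i j k : h \is n.-homog -> forms (n%:Z + d.-1%:Z) (rotation h i j k).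
Proof.
move=> hh; rewrite addrC; apply: formsM => //; apply: formsB.
  by case: (k == i); rewrite ?mul1r ?mul0r; [exact: gradient_degree | exact: forms0].
by case: (k == j); rewrite ?mul1r ?mul0r; [exact: gradient_degree | exact: forms0].
Qed.

(** If [vfield] vanished on all the fields [x_l ^ n * (f_j d_i - f_i d_j)], their minors
with [x] would show that [f] divides [x_l ^ n * x_k * f_i] for all [l], [k] and [i], hence
divides [f_i], which has smaller degree; then [f_i = 0] for all [i], and [f = 0] by
Euler's formula. *)
Lemma nonzero_vfield n : exists a, [/\ forall k, forms (n%:Z + d.-1%:Z) (a k), tangent f a &
  vfield f a <> 0].
Proof.
have [f0 hf sm] := smooth_f; apply: contrapT => no.
have hX l : ('X_l : P) ^+ n \is n.-homog by have := dhomogMn n (homogX C l); rewrite mul1n.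
have rot0 l i j : vfield f (rotation ('X_l ^+ n) i j) = 0.
  apply: contrapT => ne; apply: no; exists (rotation ('X_l ^+ n) i j); split=> // [k|].
    exact: rotation_degree.
  exact: rotation_tangent.
have minors l i j := vfield_eq0_minors (rotation_tangent ('X_l ^+ n) i j) (rot0 l i j).
have M := multiples_ideal f.
have off l k i : k != i -> multiples f ('X_l ^+ n * ('X_k * f^`M(i))).
  move=> ki; have [j [ji jk]] := avoid2 i k; have := minors l i j j k.
  rewrite /rotation (negbTE ji) (negbTE ki) eqxx [k == j]eq_sym (negbTE jk).
  set h := 'X_l ^+ n; set x := f^`M(i); set y := f^`M(j).
  suff -> : 'X_j * (h * (0%:R * y - 0%:R * x)) - 'X_k * (h * (0%:R * y - 1%:R * x)) =
    h * ('X_k * x) by [].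
  by move: ('X_j : P) ('X_k : P) h x y => *; ring.
have pair l i j : j != i ->
    multiples f ('X_l ^+ n * ('X_i * f^`M(i)) + 'X_l ^+ n * ('X_j * f^`M(j))).
  move=> ji; have := minors l i j j i; rewrite /rotation !eqxx [i == j]eq_sym (negbTE ji).
  set h := 'X_l ^+ n; set x := f^`M(i); set y := f^`M(j).
  suff -> : 'X_j * (h * (1%:R * y - 0%:R * x)) - 'X_i * (h * (0%:R * y - 1%:R * x)) =
    h * ('X_i * x) + h * ('X_j * y) by [].
  by move: ('X_j : P) ('X_i : P) h x y => *; ring.
have diag l i : multiples f ('X_l ^+ n * ('X_i * f^`M(i))).
  have [j [ji _]] := avoid2 i i; have [k [ki kj]] := avoid2 i j.
  exact: multiples_half (pair l i j ji) (pair l i k ki) (pair l j k kj).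
have grad i : multiples f f^`M(i).
  apply: (torsion_free (powers_in_pow C 3 n) f0 isT) => l.
  apply: (X_torsion_free f0 isT) => k; rewrite mulrCA.
  by have [->|/off//] := eqVneq k i; exact: diag.
have grad0 i : f^`M(i) = 0.
  have [r hr] := grad i; have := gradient_degree i.
  have dE : d.-1%:Z = -1 + d%:Z by move: d0; lia.
  move=> /(form_part_id (k := d.-1%:Z)) <-; rewrite dE hr (form_partM _ _ hf) mulr0 //.
move/eqP: f0; apply; have := euler hf; rewrite big1 => [/esym/eqP|i _]; last by rewrite grad0 mulr0.
by rewrite -scaler_nat scaler_eq0 pnatr_eq0 eqn0Ngt d0 => /eqP.
Qed.

End Kernel.

(** * Dimensions of spaces of forms and maps *)

Section Dimension.
Variable K : fieldType.

Lemma has_dimP (M : lmodType K) (S : set M) n (phi : 'rV[K]_n -> M) :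
  linear phi -> (forall x, phi x = 0 -> x = 0) -> (forall y, S y <-> exists x, y = phi x) ->
  has_dim S n.
Proof.
move=> lin inj surj; pose L := GRing.isLinear.Build K _ _ _ phi lin.
pose Phi : {linear 'rV[K]_n -> M} := HB.pack phi L.
exists Phi; split=> [x y /= E|]; last first.
  by apply/seteqP; split=> [_ [x _ <-]|y /surj[x ->]]; [apply/surj; exists x | exists x].
have E' : Phi (x - y) = 0 by rewrite linearB /= E subrr.
exact/subr0_eq/inj.
Qed.

Lemma has_dim_elim (M : lmodType K) (S : set M) n : has_dim S n ->
  exists phi : {linear 'rV[K]_n -> M},
    (forall x, phi x = 0 -> x = 0) /\ (forall y, S y <-> exists x, y = phi x).
Proof.
move=> [phi [inj img]]; exists phi; split=> [x|y].
  by rewrite -(linear0 phi) => /inj.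
by rewrite -img; split=> [[x _ <-]|[x ->]]; [exists x | exists x].
Qed.

(** The image is parametrized by a complement of the subspace of coordinates of the
kernel. *)
Lemma has_dim_kernel_image (M M' : lmodType K) (S : set M) (g : M -> M') n k :
  linear g -> has_dim S n -> has_dim (S `&` [set u | g u = 0]) k ->
  (k <= n)%N /\ has_dim [set g u | u in S] (n - k).
Proof.
move=> lin /has_dim_elim[phi [pinj pimg]] /has_dim_elim[psi [sinj simg]].
pose G : {linear M -> M'} := HB.pack g (GRing.isLinear.Build K _ _ _ g lin).
have /choice[r hr] (i : 'I_k) : exists x, psi (delta_mx 0 i) = phi x.
  have : (S `&` [set u | g u = 0]) (psi (delta_mx 0 i)) by apply/simg; exists (delta_mx 0 i).
  by case=> /pimg.
pose A : 'M[K]_(k, n) := \matrix_i r i.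
have phiA x : phi (x *m A) = psi x.
  rewrite mulmx_sum_row linear_sum [in RHS](row_sum_delta x) linear_sum.
  by apply: eq_bigr => i _; rewrite !linearZ /= rowK hr.
have freeA : row_free A.
  rewrite -kermx_eq0; apply/eqP/row_matrixP => i; rewrite row0; apply: sinj.
  by rewrite -phiA -row_mul mulmx_ker row0 linear0.
have rkA : \rank A = k by apply/eqP.
split; first by rewrite -rkA rank_leq_col.
rewrite -rkA -mxrank_compl.
apply: (@has_dimP _ _ _ (fun x => G (phi (x *m row_base A^C)%MS))).
- by move=> c x y; rewrite mulmxDl -scalemxAl !linearP.
- move=> x gx.
  have : (S `&` [set u | g u = 0]) (phi (x *m row_base A^C)%MS).
    by split=> //; apply/pimg; exists (x *m row_base A^C)%MS.
  case/simg => y; rewrite -phiA => E.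
  have {}E : (x *m row_base A^C)%MS = y *m A.
    by apply/subr0_eq/pinj; rewrite linearB /= E subrr.
  have : ((x *m row_base A^C)%MS <= A :&: A^C)%MS.
    rewrite sub_capmx {1}E submxMl /=.
    by apply: submx_trans (submxMl _ _) _; rewrite eq_row_base.
  rewrite capmx_compl submx0 => /eqP x0.
  by apply: (row_free_inj (row_base_free A^C)%MS); rewrite x0 mul0mx.
- move=> y; split=> [[u /pimg[z ->] <-]|[x ->]]; last first.
    by exists (phi (x *m row_base A^C)%MS) => //; apply/pimg; exists (x *m row_base A^C)%MS.
  have : (z <= A + A^C)%MS by rewrite submx_full // addsmx_compl_full.
  case/sub_addsmxP => -[a b] /= ->; have : (b *m A^C <= row_base A^C)%MS.
    by rewrite eq_row_base submxMl.
  case/submxP => x ->; exists x; rewrite linearD /= phiA.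
  have /simg[_ /= ga] : exists x, psi a = psi x by exists a.
  exact: etrans (linearD G _ _) (etrans (congr1 (+%R^~ _) ga) (add0r _)).
Qed.

Lemma has_dim_trivial (M : lmodType K) : has_dim [set 0 : M] 0.
Proof.
apply: (@has_dimP _ _ _ (fun=> 0)) => [c x y|x _|y].
- by rewrite scaler0 addr0.
- by apply/rowP => -[].
- by split=> [->|[]//]; exists 0.
Qed.

Lemma has_dim_unique0 (M : lmodType K) (S : set M) : has_dim S 0 -> forall y, S y -> y = 0.
Proof.
move=> /has_dim_elim[phi [_ img]] y /img[x ->].
by rewrite (_ : x = 0) ?linear0 //; apply/rowP => -[].
Qed.

Lemma has_dim_image (M M' : lmodType K) (S : set M) (g : M -> M') n :
  linear g -> has_dim S n -> (forall u, S u -> g u = 0 -> u = 0) -> has_dim [set g u | u in S] n.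
Proof.
move=> lin hS inj; have S0 : S 0.
  by have [phi [_ img]] := has_dim_elim hS; apply/img; exists 0; rewrite linear0.
have g0 : g 0 = 0 by have := lin (-1) 0 0; rewrite scaler0 addr0 => {1}->; rewrite scaleN1r addNr.
have [|_] := has_dim_kernel_image (k := 0) lin hS; last by rewrite subn0.
rewrite (_ : _ `&` _ = [set 0]); first exact: has_dim_trivial.
by apply/seteqP; split=> [u [/= Su gu]|_ ->] //=; exact: inj.
Qed.

Lemma has_dim_functions (T : finType) (Q : pred T) (M : lmodType K) (S : set M) n :
  has_dim S n ->
  has_dim [set u : T -> M | forall t, if Q t then S (u t) else u t = 0] (#|Q| * n).
Proof.
move=> /has_dim_elim[phi [pinj pimg]].
pose F (x : 'rV[K]_(#|Q| * n)) : T -> M := fun t =>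
  \sum_(i < #|Q| | enum_val i == t) phi (row i (vec_mx x)).
have FE x i : F x (enum_val i) = phi (row i (vec_mx x)).
  rewrite /F (bigD1 i) //= big1 ?addr0 // => j /andP[/eqP/enum_val_inj ->].
  by rewrite eqxx.
have F0 x t : ~~ Q t -> F x t = 0.
  by move=> Qt; rewrite /F big1 // => i /eqP E; case/negP: Qt; rewrite -E; exact: (enum_valP i).
apply: (@has_dimP _ _ _ F).
- move=> c x y; apply/funext => t.
  rewrite [RHS](_ : _ = c *: F x t + F y t) // scaler_sumr -big_split; apply: eq_bigr => i _.
  by rewrite linearP linearP linearP.
- move=> x Fx; have v0 : vec_mx x = 0.
    by apply/row_matrixP => i; rewrite row0; apply: pinj; rewrite -FE Fx.
  by rewrite -[x]vec_mxK v0 linear0.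
move=> u; split=> [hu|[x ->] t]; last first.
  case: ifP => Qt; last by rewrite F0 ?Qt.
  rewrite -[t](enum_rankK_in (Qt : t \in Q) Qt) FE; apply/pimg.
  by exists (row (enum_rank_in Qt t) (vec_mx x)).
have /choice[y hy] (i : 'I_#|Q|) : exists y, u (enum_val i) = phi y.
  by have := hu (enum_val i); rewrite (enum_valP i : Q (enum_val i)) => /pimg.
exists (mxvec (\matrix_i y i)); apply/funext => t; have := hu t; case: ifP => Qt.
  by move=> _; rewrite -[t](enum_rankK_in (Qt : t \in Q) Qt) FE mxvecK rowK hy.
by move=> ->; rewrite F0 ?Qt.
Qed.

Definition nb_forms (k : int) : nat := if k is Posz m then 'C(m + 3, 3) else 0.

Lemma has_dim_forms k : has_dim (@forms K 4 k) (nb_forms k).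
Proof.
case: k => [m|m]; last exact: has_dim_trivial.
have [g lin [h gh hg]] := dhomog_vecaxiom 3 K m.
rewrite /= -(bin_sub (leq_addl m 3)) addnK.
apply: (@has_dimP _ _ _ (fun x => mpoly_of_dhomog (h x))).
- move=> c x y; rewrite -linearP; congr mpoly_of_dhomog; apply: (can_inj gh).
  by rewrite lin !hg.
- move=> x hx; rewrite -[x]hg; have -> : h x = 0 by apply: val_inj.
  by have := lin (-1) 0 0; rewrite scaler0 addr0 scaleN1r addNr.
- move=> y; split=> [hy|[x ->]]; last by case: (h x).
  by exists (g (DHomog hy)); rewrite gh.
Qed.

End Dimension.

(** * Syzygies of a homogeneous system of parameters *)

Section Syzygies.
Variables (K : fieldType) (g : 'I_4 -> {mpoly K[4]}) (m e : nat).
Local Notation P := {mpoly K[4]}.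
Local Notation cochain := ({set 'I_4} -> P).
Hypotheses (hg : forall i, g i \is m.-homog) (pg : powers_in g e).

Definition cochains (r : nat) (k : int) : set cochain :=
  [set u | forall S : {set 'I_4}, if #|S| == r then forms k (u S) else u S = 0].

Definition cocycles (r : nat) (k : int) : set cochain :=
  cochains r k `&` [set u | skoszul g u = 0].

Lemma has_dim_cochains r k : has_dim (cochains r k) ('C(4, r) * nb_forms k).
Proof.
have <- : #|(fun S : {set 'I_4} => #|S| == r)| = 'C(4, r).
  by rewrite -[in RHS](card_ord 4) -(card_draws 'I_4 r) cardsE.
by apply: has_dim_functions; exact: has_dim_forms.
Qed.

Lemma skoszul_linear : linear (skoszul g : cochain -> cochain).
Proof.
move=> c u v; apply/funext => S.
rewrite [RHS](_ : _ = c *: skoszul g u S + skoszul g v S) // scaler_sumr -big_split.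
apply: eq_bigr => i _ /=.
rewrite (_ : (c *: u + v) (S :\ i)%SET = c *: u (S :\ i)%SET + v (S :\ i)%SET) //.
by rewrite mulrDr scalerAr.
Qed.

Lemma signed_homog i (S : {set 'I_4}) : ksgn P i S * g i \is m.-homog.
Proof.
rewrite /ksgn -signr_odd; case: (odd _); rewrite ?mul1r // expr1 mulN1r.
by rewrite dhomogN.
Qed.

Lemma form_part_skoszul k u S :
  form_part (k + m%:Z) (skoszul g u S) = skoszul g (fun T => form_part k (u T)) S.
Proof.
rewrite /skoszul form_part_sum; apply: eq_bigr => i _.
by rewrite (form_partM _ _ (signed_homog i S)).
Qed.

Lemma skoszul_cochains r k u : cochains r k u -> cochains r.+1 (k + m%:Z) (skoszul g u).
Proof.
move=> hu S; have cS i : i \in S -> #|S| = #|(S :\ i)%SET|.+1.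
  by move=> iS; rewrite (cardsD1 i) iS.
case: ifP => [/eqP Sr|Sr].
  apply: forms_sum => i iS; apply: formsM; first exact: signed_homog.
  by have := hu (S :\ i)%SET; move: Sr; rewrite (cS i iS) => -[->]; rewrite eqxx.
rewrite /skoszul big1 // => i iS; have := hu (S :\ i)%SET.
by move: Sr; rewrite (cS i iS) eqSS => -> ->; rewrite mulr0.
Qed.

Lemma skoszul_skoszul (u : cochain) : skoszul g (skoszul g u) = 0.
Proof. by apply/funext => S; have [_ _ h _ _] := skoszul_differential g; exact: h. Qed.

Lemma cocycles0 k : cocycles 0 k = [set 0].
Proof.
apply/seteqP; split=> [u [hu du]|_ ->]; last first.
  split=> [S|/=]; first by case: ifP => _ //; exact: forms0.
  by apply/funext => S; rewrite /skoszul big1 // => i _; rewrite mulr0.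
have [|w hw] := @skoszul_exact _ 3 g e pg 0 u isT; first by move=> S _; rewrite du.
apply/funext => S; have := hu S; case: eqP => [S0 _|//].
rewrite (hw S S0); have [_ _ _ h _] := skoszul_differential g; exact: h.
Qed.

(** Exactness yields some cochain [w]; its components of the right rank and degree do
as well, because the differential is homogeneous. *)
Lemma cocyclesS r k : (r.+1 < 4)%N ->
  cocycles r.+1 k = [set skoszul g u | u in cochains r (k - m%:Z)].
Proof.
move=> r3; apply/seteqP; split=> [u [hu du]|_ [w hw <-]]; last first.
  by split; [have := skoszul_cochains hw; rewrite subrK | exact: skoszul_skoszul].
have [|w hw] := @skoszul_exact _ 3 g e pg r.+1 u r3; first by move=> S _; rewrite du.
(* The component of [w] in rank [r] and degree [k - m]. *)
pose w' (S : {set 'I_4}) := if #|S| == r then form_part (k - m%:Z) (w S) else 0.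
have hw' : cochains r (k - m%:Z) w'.
  by move=> S; rewrite /w'; case: (#|S| == r) => //; exact: form_partP.
exists w' => //; apply/funext => S.
have := hu S; have := skoszul_cochains hw' S; case: eqP => [Sr|_]; last by move=> -> ->.
move=> _ /form_part_id <-; rewrite (hw S Sr) -[k in RHS](subrK m%:Z) form_part_skoszul.
apply: eq_bigr => i iS; congr (_ * _); rewrite /w'.
have Sr' : #|(S :\ i)%SET| = r by move: Sr; rewrite (cardsD1 i) iS => -[].
by rewrite Sr' eqxx.
Qed.

Fixpoint cocycle_dim (r : nat) (k : int) : nat :=
  if r is r'.+1 then ('C(4, r') * nb_forms (k - m%:Z) - cocycle_dim r' (k - m%:Z))%N else 0%N.

Lemma has_dim_cocycles r k : (r < 4)%N -> has_dim (cocycles r k) (cocycle_dim r k).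
Proof.
elim: r k => [|r IH] k hr; first by rewrite cocycles0; exact: has_dim_trivial.
rewrite cocyclesS //=.
by have [] := has_dim_kernel_image skoszul_linear (has_dim_cochains r (k - m%:Z)) (IH _ (ltnW hr)).
Qed.

Lemma cocycle_dimS r k : (r < 4)%N ->
  (cocycle_dim r.+1 k)%:Z = ('C(4, r) * nb_forms (k - m%:Z))%:Z - (cocycle_dim r (k - m%:Z))%:Z.
Proof.
move=> hr; have [h _] := has_dim_kernel_image skoszul_linear
  (has_dim_cochains r (k - m%:Z)) (has_dim_cocycles (k - m%:Z) hr).
by rewrite /= subzn.
Qed.

Lemma cocycle_dim3 k : (cocycle_dim 3 k)%:Z =
  6 * (nb_forms (k - m%:Z))%:Z - 4 * (nb_forms (k - m%:Z - m%:Z))%:Z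
  + (nb_forms (k - m%:Z - m%:Z - m%:Z))%:Z.
Proof.
rewrite !cocycle_dimS // !PoszM.
rewrite (_ : 'C(4, 2) = 6%N) // (_ : 'C(4, 1) = 4%N) // (_ : 'C(4, 0) = 1%N) //.
by rewrite [cocycle_dim 0 _](_ : _ = 0%N) //; ring.
Qed.

Definition syzygies (k : int) : set ('I_4 -> P) :=
  [set a | (forall j, forms k (a j)) /\ \sum_j a j * g j = 0].

(** The identification of trivectors with vectors, which turns the last Koszul
differential into the pairing with [g]. *)
Definition star (u : cochain) : 'I_4 -> P := fun i => ksgn P i [set: 'I_4]%SET * u (~: [set i])%SET.

Lemma has_dim_syzygies k : has_dim (syzygies k) (cocycle_dim 3 k).
Proof.
have cC i : #|(~: [set i] : {set 'I_4})%SET| = 3.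
  by have := cardsC [set i]%SET; rewrite card_ord cards1 => -[].
have setTD i : ([set: 'I_4] :\ i = ~: [set i])%SET by rewrite finset.setTD.
have starE u : \sum_j star u j * g j = skoszul g u [set: 'I_4]%SET.
  rewrite /skoszul; apply: eq_big => [i|i _]; first by rewrite inE.
  by rewrite setTD /star mulrAC.
have full3 (S : {set 'I_4}) : #|S| == 4 -> S = [set: 'I_4]%SET.
  by move=> /eqP S4; apply/eqP; rewrite eqEcard finset.subsetT cardsT card_ord S4.
have co3 (S : {set 'I_4}) : #|S| == 3 -> exists i, S = (~: [set i])%SET.
  move=> /eqP S3; have /cards1P[i Si] : #|(~: S)%SET| == 1%N.
    by have := cardsC S; rewrite card_ord S3 => -[] /eqP.
  by exists i; rewrite -Si finset.setCK.
have sgn_homog i k' p : forms k' p -> forms k' (ksgn P i [set: 'I_4]%SET * p).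
  by rewrite /ksgn -signr_odd; case: (odd _); rewrite ?mul1r // expr1 mulN1r; exact: formsN.
have -> : syzygies k = [set star u | u in cocycles 3 k].
  apply/seteqP; split=> [a [ha sa]|_ [u [hu du] <-]]; last first.
    split; last by rewrite starE du.
    by move=> j; apply: sgn_homog; have := hu (~: [set j])%SET; rewrite cC.
  pose u (S : {set 'I_4}) : P := \sum_(i | S == (~: [set i])%SET) ksgn P i [set: 'I_4]%SET * a i.
  have uE i : u (~: [set i])%SET = ksgn P i [set: 'I_4]%SET * a i.
    rewrite /u (bigD1 i) //= big1 ?addr0 // => j /andP[/eqP/finset.setC_inj/finset.set1_inj -> ].
    by rewrite eqxx.
  have su : star u = a by apply/funext => i; rewrite /star uE mulrA ksgn_sqr mul1r.
  exists u => //; split.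
    move=> S; case: ifP => [/co3[i ->]|S3]; first by rewrite uE; exact: sgn_homog.
    by rewrite /u big1 // => i /eqP E; rewrite E cC in S3.
  apply/funext => S; have [/eqP/full3 ->|S4] := eqVneq #|S| 4; first by rewrite -starE su.
  rewrite /skoszul big1 // => i iS; rewrite /u big1 ?mulr0 // => j /eqP E.
  by case/eqP: S4; rewrite (cardsD1 i) iS E cC.
have lin : linear (star : cochain -> 'I_4 -> P).
  move=> c u v; apply/funext => i; rewrite [RHS](_ : _ = c *: star u i + star v i) //.
  rewrite /star (_ : (c *: u + v) _ = c *: u (~: [set i])%SET + v (~: [set i])%SET) //.
  by rewrite mulrDr scalerAr.
apply: (has_dim_image lin (has_dim_cocycles k _)) => // u [hu _] su; apply/funext => S.
have := hu S; case: ifP => [/co3[i ->] _|_ //].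
have /(congr1 (fun x => ksgn P i [set: 'I_4]%SET * x)) := congr1 (fun a => a i) su.
by rewrite /star mulrA ksgn_sqr mul1r mulr0.
Qed.

End Syzygies.

(** * Counting *)

Section Binomials.

Lemma nb_forms_binz k : (nb_forms k)%:Z = binz (k + 3) 3.
Proof. by case: k => [m //|[|[|[|m]]]]. Qed.

Lemma nb_forms_neg k : k < 0 -> nb_forms k = 0%N.
Proof. by case: k. Qed.

Lemma ffact_nat n : 6 * 'C(n.+2, 3)%:Z = n.+2%:Z * n.+1%:Z * n%:Z /\
  2 * 'C(n.+1, 2)%:Z = n.+1%:Z * n%:Z.
Proof.
have h3 := bin_ffact n.+2 3; have h2 := bin_ffact n.+1 2.
rewrite !ffactnS ffactn0 /= in h3 h2.
rewrite (_ : 3`! = 6%N) // in h3; rewrite (_ : 2`! = 2%N) // in h2.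
by move: ('C(_, _)) ('C(_, _)) h3 h2 => x y; lia.
Qed.

Lemma binz3 a : 0 <= a -> 6 * binz a 3 = a * (a - 1) * (a - 2).
Proof.
case: a => // -[|[|n]] _ //; have [h _] := ffact_nat n.
by rewrite /binz h; rewrite !intS; ring.
Qed.

Lemma binz2 a : 0 <= a -> 2 * binz a 2 = a * (a - 1).
Proof.
case: a => // -[|n] _ //; have [_ h] := ffact_nat n.
by rewrite /binz h; rewrite !intS; ring.
Qed.

Lemma binz1 a : 0 <= a -> binz a 1 = a.
Proof. by case: a => // n _; rewrite /binz bin1. Qed.

Lemma binz_neg a b : a < 0 -> binz a b = 0.
Proof. by case: a. Qed.

Lemma binz3_small a : a <= 2 -> binz a 3 = 0.
Proof. by case: a => // -[|[|[|n]]]. Qed.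

Lemma count_first (k : int) :
  6 * (nb_forms (k + 1))%:Z - 4 * (nb_forms k)%:Z + (nb_forms (k - 1))%:Z =
  binz (5 + k) 2 * binz (2 + k) 1.
Proof.
have [hk|hk] := lerP (-2) k; last first.
  by rewrite !nb_forms_neg ?(binz_neg _ (a := 2 + k)) ?mulr0 //; lia.
rewrite !nb_forms_binz (binz1 (a := 2 + k)); last by lia.
have h1 : 2 * binz (5 + k) 2 = (5 + k) * (5 + k - 1) by apply: binz2; lia.
have h2 : 6 * binz (k - 1 + 3) 3 = (k - 1 + 3) * (k - 1 + 3 - 1) * (k - 1 + 3 - 2).
  by apply: binz3; lia.
have h3 : 6 * binz (k + 3) 3 = (k + 3) * (k + 3 - 1) * (k + 3 - 2) by apply: binz3; lia.
have h4 : 6 * binz (k + 1 + 3) 3 = (k + 1 + 3) * (k + 1 + 3 - 1) * (k + 1 + 3 - 2).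
  by apply: binz3; lia.
move: (binz (5 + k) 2) (binz (k - 1 + 3) 3) (binz (k + 3) 3) (binz (k + 1 + 3) 3) h1 h2 h3 h4.
move=> x y z t h1 h2 h3 h4.
have h1k : 2 * (x * (2 + k)) = (5 + k) * (5 + k - 1) * (2 + k) by rewrite -h1; ring.
move: (x * (2 + k)) h1k => u hu; lia.
Qed.

(** For [j = -3] the space of forms of degree [-1] is zero while the binomial coefficients
on the right add up to [1]; this is the exceptional case of the formula. *)
Lemma count_second (j : int) :
  4 * (nb_forms (j + 2))%:Z =
  binz (5 + j) 2 * binz (2 + j) 1 + binz (6 + j) 3 - (if j == - 3 then 1 else 0).
Proof.
have [hj|hj] := lerP (-2) j.
  rewrite nb_forms_binz (binz1 (a := 2 + j)); last by lia.
  have -> : (j == - 3) = false by lia.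
  have h1 : 2 * binz (5 + j) 2 = (5 + j) * (5 + j - 1) by apply: binz2; lia.
  have h2 : 6 * binz (j + 2 + 3) 3 = (j + 2 + 3) * (j + 2 + 3 - 1) * (j + 2 + 3 - 2).
    by apply: binz3; lia.
  have h3 : 6 * binz (6 + j) 3 = (6 + j) * (6 + j - 1) * (6 + j - 2) by apply: binz3; lia.
  move: (binz (5 + j) 2) (binz (j + 2 + 3) 3) (binz (6 + j) 3) h1 h2 h3.
  move=> x y z h1 h2 h3.
  have h1j : 2 * (x * (2 + j)) = (5 + j) * (5 + j - 1) * (2 + j) by rewrite -h1; ring.
  move: (x * (2 + j)) h1j => u hu; lia.
rewrite nb_forms_neg ?(binz_neg _ (a := 2 + j)) ?mulr0 ?add0r; [|lia..].
by case: eqP => [->//|h]; rewrite binz3_small ?subr0 //; lia.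
Qed.

Lemma count_sections (d d1 : int) :
  6 * (nb_forms (d - (d1 - 1)))%:Z - 4 * (nb_forms (d - (d1 - 1) - (d1 - 1)))%:Z
    + (nb_forms (d - (d1 - 1) - (d1 - 1) - (d1 - 1)))%:Z
    - (4 * (nb_forms (d - d1))%:Z - (nb_forms (d - d1 - 1))%:Z) =
  if d == - 3 + 2 * d1 then T d d1 + 1 else T d d1.
Proof.
have h1 := count_first (d - d1); have h2 := count_second (d - 2 * d1).
have h3 := nb_forms_binz (d - 3 * d1 + 3).
rewrite (_ : d - d1 + 1 = d - (d1 - 1)) in h1; last by ring.
rewrite (_ : d - 2 * d1 + 2 = d - (d1 - 1) - (d1 - 1)) in h2; last by ring.
rewrite (_ : d - 3 * d1 + 3 + 3 = 6 + d - 3 * d1) in h3; last by ring.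
rewrite (_ : d - 3 * d1 + 3 = d - (d1 - 1) - (d1 - 1) - (d1 - 1)) in h3; last by ring.
rewrite !addrA in h1 h2.
rewrite (_ : (d - 2 * d1 == - 3) = (d == - 3 + 2 * d1)) in h2; last by lia.
rewrite /T; move: h1 h2 h3.
move: (binz (5 + d - d1) 2 * binz (2 + d - d1) 1) (binz (6 + d - 2 * d1) 3).
move: (binz (5 + d - 2 * d1) 2 * binz (2 + d - 2 * d1) 1) (binz (6 + d - 3 * d1) 3).
move: (nb_forms (d - (d1 - 1) - (d1 - 1) - (d1 - 1))) (nb_forms (d - (d1 - 1) - (d1 - 1))).
move: (nb_forms (d - (d1 - 1))) (nb_forms (d - d1 - 1)) (nb_forms (d - d1)).
by case: ifP => *; lia.
Qed.

End Binomials.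

Section Main.
Variables (R : realType) (f : {mpoly R[i][4]}) (d1 : nat).
Local Notation C := R[i].
Local Notation V := ('I_4 -> C).
Local Notation fct := (V -> C^o).
Local Notation family := (set V -> fct -> fct).
Local Notation P := {mpoly C[4]}.
Hypotheses (d0 : (0 < d1)%N) (smooth_f : smooth_hypersurface f d1).
Local Notation g := (fun j => f^`M(j)).

Lemma H0_ThetaE e : H0_Theta f e = [set vfield f a | a in syzygies g (e + 1)].
Proof.
rewrite /H0_Theta Theta_twistE; apply/seteqP; split=> [D|_ [a [ha ta] <-]].
  by case/(derivation_is_vfield d0 smooth_f) => a [ha ta ->]; exists a.
exact: (vfield_derivation d0 smooth_f (e := e) (a := a) ha ta).
Qed.

(** The component [f * w] of a field in the kernel of [vfield], corrected by the multiple
of the Euler field that makes it orthogonal to the gradient. *)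
Definition radial (w : 'I_4 -> P) : 'I_4 -> P :=
  fun j => f * w j - d1%:R^-1 *: ((\sum_k w k * f^`M(k)) * 'X_j).

Lemma radial_linear : linear radial.
Proof.
move=> c u v; apply/funext => j.
rewrite [RHS](_ : _ = c *: radial u j + radial v j) // /radial.
rewrite (_ : (c *: u + v) j = c *: u j + v j) //.
rewrite (_ : \sum_k _ = c *: (\sum_k u k * f^`M(k)) + \sum_k v k * f^`M(k)); last first.
  by rewrite scaler_sumr -big_split; apply: eq_bigr => k _; rewrite /= scalerAl -mulrDl.
rewrite mulrDr mulrDl -scalerAr -scalerAl scalerDr scalerBr !scalerA [_ * c]mulrC.
by rewrite opprD addrACA.
Qed.

Lemma dnat_neq0 : (d1%:R : C) != 0. Proof. by rewrite pnatr_eq0 -lt0n. Qed.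

Lemma radial_tangent w : \sum_j radial w j * f^`M(j) = 0.
Proof.
have [f0 hf sm] := smooth_f.
rewrite /radial; under eq_bigr do rewrite mulrBl -scalerAl -!mulrA.
rewrite sumrB -scaler_sumr -!mulr_sumr (euler hf).
move: (\sum_k w k * f^`M(k)) => s; rewrite mulrnAr.
have -> : s * f *+ d1 = (d1%:R : C) *: (s * f) by rewrite scaler_nat.
by rewrite scalerA mulVf ?dnat_neq0 // scale1r mulrC subrr.
Qed.

Lemma kernel_radial k : syzygies g k `&` [set a | vfield f a = 0] =
  [set radial w | w in [set w | forall j, if xpredT j then forms (k - d1%:Z) (w j) else w j = 0]].
Proof.
have [f0 hf sm] := smooth_f.
have kE : k - 1 + 1 = k by ring.
apply/seteqP; split=> [a [[ha ta] a0]|_ [w hw <-]].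
  rewrite -kE in ha; have [h _] := vfield_eq0P d0 smooth_f ha ta.
  have [c [w [_ hw aE]]] := h a0; rewrite kE in hw.
  exists w => //; apply/funext => j; rewrite /radial aE.
  suff -> : c = - (d1%:R^-1 *: \sum_k w k * f^`M(k)) by rewrite mulNr scalerAl addrC.
  have : c *+ d1 + \sum_k w k * f^`M(k) = 0.
    apply: (mulfI f0); rewrite mulr0 mulrDr mulrnAr mulrC -mulrnAr -(euler hf) -[RHS]ta.
    rewrite !mulr_sumr -big_split; apply: eq_bigr => l _; rewrite /= aE mulrDl !mulrA.
    by congr (_ + _); rewrite -mulrA.
  move=> /eqP; rewrite addr_eq0 => /eqP E.
  have -> : \sum_k w k * f^`M(k) = - (c *+ d1) by rewrite E opprK.
  have -> : c *+ d1 = (d1%:R : C) *: c by rewrite scaler_nat.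
  by rewrite scalerN opprK scalerA mulVf ?dnat_neq0 // scale1r.
have hw' j : forms (k - d1%:Z) (w j) := hw j.
have hc : forms (k - 1) (- (d1%:R^-1 *: \sum_l w l * f^`M(l))).
  apply: formsN; apply: formsZ; apply: forms_sum => l _.
  have := formsM_int (hw' l) (forms_mderiv l (hf : forms d1%:Z f)); congr forms; ring.
have rE j : radial w j = - (d1%:R^-1 *: \sum_l w l * f^`M(l)) * 'X_j + f * w j.
  by rewrite /radial mulNr scalerAl addrC.
have hr j : forms (k - 1 + 1) (radial w j).
  rewrite rE; apply: formsD; first exact: formsM_int hc (homogX C j : forms 1%:Z 'X_j).
  by have := formsM hf (hw' j); congr forms; ring.
split; first by split; [rewrite -kE | exact: radial_tangent].
have [_ h] := vfield_eq0P d0 smooth_f hr (radial_tangent w); apply: h.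
by eexists; exists w; split; [exact: hc | rewrite kE | exact: rE].
Qed.

(** The equation [f * w = c * x] forces [w] to be proportional to [x]. *)
Lemma radial_kernel k :
  [set w | forall j, if xpredT j then forms k (w j) else w j = 0] `&` [set w | radial w = 0] =
  [set (fun j => h * 'X_j) | h in @forms C 4 (k - 1)].
Proof.
have [f0 hf sm] := smooth_f.
apply/seteqP; split=> [w [hw w0]|_ [h hh <-]].
  have hw' j : forms k (w j) := hw j.
  have E j : f * w j = (d1%:R^-1 *: \sum_l w l * f^`M(l)) * 'X_j.
    have := congr1 (fun r => r j) w0; rewrite /radial => /subr0_eq ->.
    by rewrite scalerAl.
  have [|h hh] := okoszul_exact (powers_in_X C 3) (r := 1)
      (u := fun s => if s is l :: _ then w l else 0) isT.
    move=> [|l [|m []]] //= _; rewrite !subr0; apply: (mulfI f0).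
    by rewrite mulr0 mulrBr mulrCA E [f * (_ * w l)]mulrCA E; ring.
  exists (form_part (k - 1) (h [::])); first exact: form_partP.
  apply/funext => j; have := hh [:: j] erefl; rewrite /= subr0 => hj.
  rewrite mulrC -(form_partM _ _ (homogX C j)) subrK -hj; exact: form_part_id.
split=> [j|/=].
  by have := formsM_int hh (homogX C j : forms 1%:Z 'X_j); rewrite subrK.
apply/funext => j; rewrite /radial.
have -> : \sum_k0 h * 'X_k0 * f^`M(k0) = (d1%:R : C) *: (h * f).
  rewrite scaler_nat -mulrnAr -(euler hf) mulr_sumr.
  by apply: eq_bigr => l _; rewrite mulrA.
by rewrite -scalerAl scalerA mulVf ?dnat_neq0 // scale1r mulrCA mulrA subrr.
Qed.

Lemma has_dim_H0 d : exists2 h0 : nat, has_dim (H0_Theta f (d - 1)) h0 &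
  h0%:Z = 6 * (nb_forms (d - (d1%:Z - 1)))%:Z - 4 * (nb_forms (d - (d1%:Z - 1) - (d1%:Z - 1)))%:Z
    + (nb_forms (d - (d1%:Z - 1) - (d1%:Z - 1) - (d1%:Z - 1)))%:Z
    - (4 * (nb_forms (d - d1%:Z))%:Z - (nb_forms (d - d1%:Z - 1))%:Z).
Proof.
have [f0 hf sm] := smooth_f.
have [e pg] := powers_in_gradient (@complex_uncountable R) hf d0 sm.
have hg := gradient_degree d0 smooth_f.
have dS := has_dim_syzygies hg pg d.
have zE := cocycle_dim3 hg pg d.
have lin1 : linear (fun h : P => (fun j => h * 'X_j) : 'I_4 -> P).
  move=> c u v; apply/funext => j.
  by rewrite [RHS](_ : _ = c *: (u * 'X_j) + v * 'X_j) // mulrDl scalerAl.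
have d1' : has_dim [set (fun j => h * 'X_j) | h in @forms C 4 (d - d1%:Z - 1)]
    (nb_forms (d - d1%:Z - 1)).
  apply: (has_dim_image lin1 (has_dim_forms C _)) => u _ /(congr1 (fun r => r ord0)) /eqP.
  rewrite mulf_eq0 => /orP[/eqP//|/eqP X0].
  have := congr1 (meval (fun=> 1)) X0; rewrite mevalXU meval0 => /eqP.
  by rewrite oner_eq0.
have d2 := has_dim_functions (T := 'I_4) xpredT (has_dim_forms C (d - d1%:Z)).
rewrite -radial_kernel in d1'.
have [le1 d3] := has_dim_kernel_image radial_linear d2 d1'.
rewrite -kernel_radial in d3.
have lin2 : linear (vfield f) by move=> c a b; exact: vfield_lin.
have [le2 d4] := has_dim_kernel_image lin2 dS d3.
exists (cocycle_dim d1.-1 3 d -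
  (#|xpredT : pred 'I_4| * nb_forms (d - d1%:Z) - nb_forms (d - d1%:Z - 1)))%N.
  by rewrite H0_ThetaE subrK.
rewrite -subzn // -subzn // zE PoszM (_ : #|_| = 4%N) ?card_ord //.
by rewrite (_ : d1.-1%:Z = d1%:Z - 1) //; move: d0; lia.
Qed.

End Main.

Theorem proposition2p1 (R : realType) (f : {mpoly R[i][4]}) (d1 : nat)
    (d : int) (hd1 : (2 <= d1)%N) (hf : smooth_hypersurface f d1) :
  ((exists F, foliations f (1 - d) F) <-> d1%:Z - 1 <= d) /\
  (exists2 h0 : nat, has_dim (H0_Theta f (d - 1)) h0 &
     h0%:Z = if d == - 3 + 2 * d1%:Z then T d d1%:Z + 1 else T d d1%:Z).
Proof.
have d0 : (0 < d1)%N by apply: leq_trans hd1.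
have [h0 dimH hE] := has_dim_H0 d0 hf d.
split; last by exists h0 => //; rewrite hE count_sections.
have eE : - (1 - d) = d - 1 by rewrite opprB.
split=> [[F [D [hD Dn0] _]]|hd].
  rewrite eE in hD; rewrite leNgt; apply/negP => hd; apply: Dn0.
  have h00 : h0 = 0%N by rewrite !nb_forms_neg in hE; lia.
  by rewrite h00 in dimH; exact: has_dim_unique0 dimH _ hD.
have [n nE] : exists n : nat, d = n%:Z + d1.-1%:Z.
  by exists (absz (d - (d1%:Z - 1))%R); lia.
have [a [ha ta a0]] := nonzero_vfield d0 hf n; rewrite -nE in ha.
exists [set c *: vfield f a | c in [set c | c != 0]]; exists (vfield f a) => //; split=> //.
by rewrite eE (H0_ThetaE d0 hf) subrK; exists a.
Qed.
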